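(* For all $d,m\in\mathbb{N}$ with $d\ge m$, there exists a constant $C(d,m)$, depending only on $d$ and $m$, such that for every $n\in\mathbb{N}$ and for any probability measures $\nu_1,\ldots,\nu_n$ on $\mathbb{R}$, each $\nu_j$ having a density $\varrho_j$ of bounded variation, one has $$\Bigl|\int_{\mathbb{R}^n}e^{itf(x)}\,\nu_1(dx_1)\ldots\nu_n(dx_n)\Bigr|\le\bigl(1+\max_{1\le j\le n}\|\varrho_j\|_{\dot{BV}(\mathbb{R})}\bigr)^{d/m}\frac{C(d,m)}{([f]_\infty|t|)^{1/m}}\bigl(|\ln([f]_\infty|t|)|^{d-m}+1\bigr)$$ for every $t\in\mathbb{R}\setminus\{0\}$ and every non-constant $f\in\mathcal{P}_{d,m}(\mathbb{R}^n)$.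
   Context: $\mathbb{N}=\{1,2,\dots\}$. $\mathcal{P}_{d,m}(\mathbb{R}^n)$ is the space of all real polynomials in $n$ variables of total degree at most $d$ whose degree in each individual variable is at most $m$, i.e. $f(x)=\sum_{j_1+\ldots+j_n\le d,\ \max_i j_i\le m}a_{j_1,\ldots,j_n}x_1^{j_1}\cdots x_n^{j_n}$. For such $f$ put $$d(f):=\max\{j_1+\ldots+j_n:\ a_{j_1,\ldots,j_n}\ne0\},\qquad [f]_\infty:=\max\{|a_{j_1,\ldots,j_n}|:\ j_1+\ldots+j_n=d(f)\}.$$ For $\varrho\in L^1(\mathbb{R})$, $\|\varrho\|_{\dot{BV}(\mathbb{R})}:=\sup_{\varepsilon>0}\varepsilon^{-1}\sup_{|h|\le\varepsilon}\int_{\mathbb{R}}|\varrho(x+h)-\varrho(x)|\,dx$, and $\varrho$ is of bounded variation if this is finite. *)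

(* Defs.v *)
From HB Require Import structures.
From mathcomp Require Import all_boot all_order all_algebra.
From mathcomp Require Import all_classical all_reals all_analysis.
(* The notations of mpoly clash with those of the analysis library. *)
From mathcomp Require Import -(notations) mpoly.
From mathcomp.real_closed Require Import complex.

Set Implicit Arguments.
Unset Strict Implicit.
Unset Printing Implicit Defensive.

Import Order.TTheory GRing.Theory Num.Theory.
Import numFieldNormedType.Exports.

Local Open Scope classical_set_scope.
Local Open Scope ring_scope.

Definition tcons d (T : measurableType d) (n : nat) (x : T * n.-tuple T) :
  n.+1.-tuple T := [tuple of x.1 :: x.2].

Lemma measurable_tcons d (T : measurableType d) (n : nat) :
  measurable_fun [set: T * n.-tuple T] (@tcons d T n).
Proof. exact: measurable_cons. Qed.

HB.instance Definition _ d (T : measurableType d) (n : nat) :=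
  isMeasurableFun.Build _ _ _ _ (@tcons d T n) (measurable_tcons (n := n)).

(* The product measure of P 0, ..., P (n - 1) on n.-tuple T: the image of
   P 0 \x (P 1 \x ...) under the measurable bijection tcons. It is determined
   by its values on boxes, see prodP_box. *)
Fixpoint prodP d (T : measurableType d) (R : realType) (n : nat) :
    ('I_n -> probability T R) -> probability (n.-tuple T) R :=
  match n with
  | 0 => fun=> \d_([tuple] : 0.-tuple T)
  | n'.+1 => fun P =>
      distribution (P ord0 \x prodP (fun i => P (lift ord0 i)))%E
        (@tcons d T n')
  end.

Lemma measurable_box d (T : measurableType d) (n : nat) (A : 'I_n -> set T) :
  (forall i, measurable (A i)) ->
  measurable [set x : n.-tuple T | forall i, A i (tnth x i)].
Proof.
move=> mA.
have -> : [set x : n.-tuple T | forall i, A i (tnth x i)] =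
    \bigcap_(i in [set: 'I_n]) ((@tnth n T ^~ i) @^-1` A i).
  by apply/seteqP; split => [x h i _|x h i] /=; [exact: h|exact: (h i)].
apply: fin_bigcap_measurable => [|i _]; first exact: finite_finset.
rewrite -[X in measurable X]setTI.
exact: (@measurable_tnth _ _ _ i measurableT _ (mA i)).
Qed.

Lemma prodP_box d (T : measurableType d) (R : realType) (n : nat)
    (P : 'I_n -> probability T R) (A : 'I_n -> set T) :
  (forall i, measurable (A i)) ->
  prodP P [set x | forall i, A i (tnth x i)] = (\prod_(i < n) P i (A i))%E.
Proof.
elim: n P A => [|n IH] P A mA.
  by rewrite big_ord0 /= diracE mem_set//=; case.
rewrite big_ord_recl /= /distribution /pushforward.
rewrite -IH; last by move=> i; exact: mA.
rewrite -product_measure1E//; last first.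
  exact: (@measurable_box _ _ _ (fun i => A (lift ord0 i)) (fun i => mA _)).
congr (_ _); apply/seteqP; split => -[x t] /=.
  move=> h; split; first by have := h ord0.
  by move=> i; have := h (lift ord0 i); rewrite /= tnthS.
move=> [Ax At] i; have [j ->|->//] := unliftP ord0 i.
by rewrite tnthS.
Qed.

Definition expi (R : realType) (theta : R) : R[i] :=
  (cos theta +i* sin theta)%C.

Definition Cintegral d (T : measurableType d) (R : realType)
    (mu : {measure set T -> \bar R}) (g : T -> R[i]) : R[i] :=
  ((\int[mu]_x complex.Re (g x)) +i* (\int[mu]_x complex.Im (g x)))%C.

(* A density of a probability measure is automatically nonnegative almost
   everywhere. *)
Definition has_density (R : realType) (nu : probability (measurableTypeR R) R)
    (rho : R -> R) : Prop :=
  lebesgue_measure.-integrable [set: R] (EFin \o rho) /\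
  forall A : set (measurableTypeR R), measurable A ->
    nu A = (\int[lebesgue_measure]_(x in A) (rho x)%:E)%E.

(* The homogeneous BV seminorm of an integrable function, defined through its
   L^1 modulus of continuity; it takes the value +oo exactly when rho is not
   of bounded variation. *)
Definition BV_seminorm (R : realType) (rho : R -> R) : \bar R :=
  ereal_sup [set (eps^-1%:E *
      ereal_sup [set \int[lebesgue_measure]_x `|rho (x + h) - rho x|%:E
                | h in [set h : R | (`|h| <= eps)%R]])%E
    | eps in [set eps : R | 0 < eps]].

(* msupp f lists the exponents whose coefficient in f is nonzero. *)
Definition in_Pdm (R : realType) (n d m : nat) (f : mpoly n R) : Prop :=
  forall j : multinom n, j \in msupp f ->
    (mdeg j <= d)%N /\ forall i : 'I_n, (j i <= m)%N.

Definition total_degree (R : realType) (n : nat) (f : mpoly n R) : nat :=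
  (\max_(j <- msupp f) mdeg j)%N.

(* The default value 0 of the maximum is only used when f = 0. *)
Definition top_coef_norm (R : realType) (n : nat) (f : mpoly n R) : R :=
  \big[Num.max/0]_(j <- msupp f | mdeg j == total_degree f)
    `|mcoeff j f|.

(* Main.v *)
Require Import Defs.
From HB Require Import structures.
From mathcomp Require Import all_boot all_order all_algebra.
From mathcomp Require Import all_classical all_reals all_analysis.
From mathcomp Require Import -(notations) mpoly.
From mathcomp.real_closed Require Import complex.
From mathcomp Require Import measurable_realfun zify ring lra.

(** The top coefficient is translation invariant, which is what makes the bound
    free of any localization of the densities. Fix a monomial [x^k] of top degree
    [D] realizing [f]_oo; variables not occurring in it are simply frozen, so
    the constant does not depend on the dimension.

    A density of variation [B] is approximated in L^1 by step functions, and Abel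
    summation on blocks of length [l = 1 / (1 + B)] writes it as a signed mixture
    of uniform laws on intervals [a, a + tau * l], [tau <= 1], of total weight
    at most 3. In the variable [x_1 = a + l * y] the polynomial becomes, for
    fixed other variables, a one-variable polynomial on [0, 1] whose coefficient
    of [y^k_1] is again a polynomial of top degree [D - k_1] with the monomial
    [x^k / x_1^k_1] and coefficient [l^k_1 * f_k].

    Two one-variable estimates on [0, 1] in terms of any coefficient [M] suffice:
    the van der Corput bound [M^(-1/m)] for the oscillatory integral (first
    variable), and the bound [C / (1 - a r) * M^(-a)] for the integral of
    [|p|^(-a)], [deg p <= r < 1/a] (remaining variables). Both follow from
    [|p(y)| >= 4^-r * M * prod_k |y - x_k|] with real [x_k]. A loss [1 / (1 - a m)]
    occurs only while the remaining degree is at least [m], hence at most [D - m]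
    times, and the choice [a = (1 - 1 / ln T) / m] turns it into [(ln T)^(D - m)]. *)

(** The obstacle is that after one integration the coefficient in the bound is itself a polynomial
    in the remaining variables, and it may vanish. Estimates are therefore written with the capped
    power [psi a u], that is max(1, u)^(-a): it makes sense at zero and appears on both sides of the
    one-variable bound for negative powers, which can thus be iterated. At exponent 1/m the negative
    power of a polynomial of degree m need not be integrable, so the oscillatory bound is
    deliberately weakened to an exponent below 1/m before the next integration; this is the source
    of the logarithms. The power of 1 + B comes from the rescaling by l: one factor l for each unit
    of the degree D of the chosen monomial, hence l^D in front of the top coefficient. Sine
    integrals are cosine integrals with a phase; the phase enters the constant term, which does not
    affect a coefficient of positive degree, so only cosines are estimated. *)

Set Implicit Arguments.
Unset Strict Implicit.
Unset Printing Implicit Defensive.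

Import Order.TTheory GRing.Theory Num.Theory.
Import numFieldNormedType.Exports.

Local Open Scope classical_set_scope.
Local Open Scope ring_scope.

(** * Lower bounds for polynomials *)

Section RootComparison.
Variable R : rcfType.
Local Notation normc := (@ComplexField.Normc.normc R).

Lemma normc_ge0 (z : R[i]) : 0 <= normc z.
Proof. by case: z => a b; exact: sqrtr_ge0. Qed.

Lemma normc_real (x : R) : normc (real_complex R x) = `|x|.
Proof. by rewrite /= expr0n addr0 sqrtr_sqr. Qed.

Lemma ler_normcD (z w : R[i]) : normc (z + w) <= normc z + normc w.
Proof. exact: le_normcD. Qed.

Lemma normc_opp (z : R[i]) : normc (- z) = normc z.
Proof. exact: normcN. Qed.

Lemma ler_Re_normc (z : R[i]) : `|complex.Re z| <= normc z.
Proof.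
case: z => a b /=; rewrite -sqrtr_sqr ler_sqrt ?addr_ge0 ?sqr_ge0//.
by rewrite lerDl sqr_ge0.
Qed.

Lemma normc_prod (zs : seq R[i]) (F : R[i] -> R[i]) :
  normc (\prod_(z <- zs) F z) = \prod_(z <- zs) normc (F z).
Proof.
elim: zs => [|z zs IH]; first by rewrite !big_nil ComplexField.Normc.normc1.
by rewrite !big_cons ComplexField.Normc.normcM IH.
Qed.

(** Multiplication by X - z turns the coefficient c_i into c_(i-1) - z c_i, which multiplies a
    uniform bound on the coefficients by at most 1 + |z|. *)
Lemma coef_prod_XsubC_le (zs : seq R[i]) (i : nat) :
  normc (\prod_(z <- zs) ('X - z%:P))`_i <= \prod_(z <- zs) (1 + normc z).
Proof.
elim: zs i => [|z zs IH] i.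
  rewrite !big_nil coefC; case: (i == 0)%N.
    by rewrite ComplexField.Normc.normc1.
  by rewrite ComplexField.Normc.normc0.
rewrite !big_cons mulrBl coefB coefXM coefCM.
apply: (le_trans (ler_normcD _ _)).
rewrite normc_opp ComplexField.Normc.normcM mulrDl mul1r lerD//.
  by case: ifP => _ //; rewrite ComplexField.Normc.normc0 prodr_ge0// => w _;
     rewrite addr_ge0 ?normc_ge0.
by rewrite ler_wpM2l ?normc_ge0.
Qed.

(* [x] is the real part of [z] if [z] is near [0, 1], and 0 otherwise: then
   [|y - 0| <= 1] is harmless. *)
Lemma real_root_proxy (z : R[i]) : exists2 x : R, `|x| <= 2 &
  forall y : R, 0 <= y <= 1 ->
    (1 + normc z) / 4 * `|y - x| <= normc (real_complex R y - z).
Proof.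
have hz := normc_ge0 z.
have [zle|zgt] := lerP (normc z) 2.
  exists (complex.Re z); first exact: le_trans (ler_Re_normc z) zle.
  move=> y _; apply: (@le_trans _ _ `|y - complex.Re z|).
    by rewrite ler_piMl//; lra.
  have := ler_Re_normc (real_complex R y - z).
  by case: (z) => a b.
exists 0; first by rewrite normr0.
move=> y /andP[y0 y1]; rewrite subr0 ger0_norm//.
have h : normc z <= normc (real_complex R y - z) + y.
  have -> : z = real_complex R y - (real_complex R y - z) by rewrite subKr.
  apply: le_trans (ler_normcD _ _) _.
  by rewrite normc_opp normc_real ger0_norm// subKr addrC.
by nra.
Qed.

(** With complex roots z and leading coefficient c, every coefficient is at most |c| times the
    product of the 1 + |z|, while |p(y)| is |c| times the product of the |y - z|. Replacing each
    root by its real proxy costs a factor 4. The points do not depend on [i] or [y]. *)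
Lemma poly_lower_bound (p : {poly R}) (r : nat) : (size p <= r.+1)%N ->
  exists xs : seq R, [/\ size xs = r, all (fun x => `|x| <= 2) xs &
    forall (i : nat) (y : R), 0 <= y <= 1 ->
      `|p`_i| * \prod_(x <- xs) `|y - x| <= 4 ^+ r * `|p.[y]|].
Proof.
move=> sp.
have [p0|pn0] := eqVneq p 0.
  exists (nseq r 0); split; rewrite ?size_nseq//.
    by apply/allP => x /nseqP[->]; rewrite normr0.
  by move=> i y _; rewrite p0 coef0 horner0 normr0 mul0r mulr0.
have [zs pE] := closed_field_poly_normal (map_poly (real_complex R) p).
set c := lead_coef _ in pE.
have c0 : c != 0.
  by rewrite /c lead_coef_eq0 map_poly_eq0.
have szs : (size zs <= r)%N.
  move: sp; rewrite -(size_map_poly (real_complex R)) pE size_scale//.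
  by rewrite size_prod_XsubC ltnS.
have key : exists xs : seq R, [/\ size xs = size zs,
    all (fun x => `|x| <= 2) xs &
    forall y : R, 0 <= y <= 1 ->
      \prod_(z <- zs) (1 + normc z) * \prod_(x <- xs) `|y - x| <=
      4 ^+ size zs * \prod_(z <- zs) normc (real_complex R y - z)].
  clear.
  elim: zs => [|z zs [xs [h1 h2 h3]]].
    by exists [::]; split => // y _; rewrite !big_nil.
  have [x x2 hx] := real_root_proxy z.
  exists (x :: xs); split => /=; rewrite ?h1 ?x2// => y y01.
  rewrite !big_cons exprS mulrACA [leRHS]mulrACA ler_pM//.
  - by rewrite mulr_ge0// addr_ge0// normc_ge0.
  - by rewrite mulr_ge0// prodr_ge0// => w _; rewrite ?addr_ge0// normc_ge0.
  - by have := hx _ y01; nra.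
  - exact: h3.
have [xs [h1 h2 h3]] := key.
(* Padding with zeros gives exactly [r] points even if the degree is smaller; the added factors |y -
   0| are at most 1. *)
exists (xs ++ nseq (r - size zs) 0); split.
- by rewrite size_cat size_nseq h1 subnKC.
- rewrite all_cat h2; apply/allP => x /nseqP[->]; by rewrite normr0.
move=> i y y01.
have hi : `|p`_i| <= normc c * \prod_(z <- zs) (1 + normc z).
  have -> : `|p`_i| = normc (map_poly (real_complex R) p)`_i.
    by rewrite coef_map; exact/esym/normc_real.
  rewrite {}pE coefZ ComplexField.Normc.normcM ler_wpM2l ?normc_ge0//.
  exact: coef_prod_XsubC_le.
have hy : `|p.[y]| = normc c * \prod_(z <- zs) normc (real_complex R y - z).
  have -> : `|p.[y]| = normc (map_poly (real_complex R) p).[real_complex R y].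
    by rewrite horner_map; exact/esym/normc_real.
  rewrite {}pE hornerZ ComplexField.Normc.normcM; congr (_ * _).
  rewrite horner_prod normc_prod; apply: eq_bigr => z _.
  by rewrite hornerXsubC.
rewrite big_cat/=.
have q1 : \prod_(x <- nseq (r - size zs) 0) `|y - x| <= 1.
  rewrite big_nseq iter_mulr_1 exprn_ile1// subr0; case/andP: y01 => y0 y1.
  by rewrite ger0_norm.
have q0 : 0 <= \prod_(x <- nseq (r - size zs) 0) `|y - x| by rewrite prodr_ge0.
have Q0 : 0 <= \prod_(x <- xs) `|y - x| by rewrite prodr_ge0.
apply: (@le_trans _ _ (`|p`_i| * \prod_(x <- xs) `|y - x|)).
  by apply: ler_wpM2l => //; rewrite ler_piMr.
apply: (le_trans (ler_wpM2r Q0 hi)); rewrite -mulrA.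
apply: (le_trans (ler_wpM2l (normc_ge0 c) (h3 _ y01))).
rewrite mulrCA -hy; apply: ler_wpM2r => //; apply: ler_weXn2l => //; lra.
Qed.

End RootComparison.

(** * Integrals over intervals *)

Section IntervalIntegral.
Context {R : realType}.
Implicit Types (f g F : R -> R) (a b c : R).
Local Notation leb := (@lebesgue_measure R).

Definition itv_int f a b : R := \int[leb]_(x in `[a, b]) f x.

Lemma cts_integrable f a b :
  (forall x : R, a <= x <= b -> {for x, continuous f}) ->
  leb.-integrable `[a, b] (EFin \o f).
Proof.
move=> cf; apply: continuous_compact_integrable; first exact: segment_compact.
by apply: continuous_in_subspaceT => x; rewrite inE/= in_itv/=; exact: cf.
Qed.

Lemma itv_int_split f a b c : a <= c <= b ->
  leb.-integrable `[a, b] (EFin \o f) ->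
  itv_int f a b = itv_int f a c + itv_int f c b.
Proof.
move=> /andP[ac cb] cf.
have := @Rintegral_itvB R f (BLeft a) (BRight b) c cf.
rewrite !bnd_simp => /(_ ac cb).
rewrite Rintegral_itv_obnd_cbnd; first by rewrite /itv_int => <-; rewrite addrC subrK.
by apply: integrableS cf => //; apply: subset_itv; rewrite bnd_simp.
Qed.

Lemma itv_int_FTC f F a b : a <= b ->
  (forall x : R, a <= x <= b -> is_derive x (1 : R) F (f x)) ->
  (forall x : R, a <= x <= b -> {for x, continuous f}) ->
  itv_int f a b = F b - F a.
Proof.
rewrite le_eqVlt => /predU1P[<- _ _|ab dF cf].
  by rewrite /itv_int set_itv1 Rintegral_set1 subrr.
rewrite /itv_int /Rintegral (@continuous_FTC2 _ f F)//.
- by apply: continuous_in_subspaceT => x; rewrite inE/= in_itv/=; exact: cf.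
- have cF (x : R) : a <= x <= b -> {for x, continuous F}.
    move=> /dF dFx; apply/differentiable_continuous/derivable1_diffP.
    by case: dFx.
  split.
  + by move=> x /subset_itv_oo_cc; rewrite in_itv/= => /dF[].
  + apply: cvg_at_right_filter; apply: cF; by rewrite lexx ltW.
  + apply: cvg_at_left_filter; apply: cF; by rewrite lexx ltW.
- by move=> x /subset_itv_oo_cc; rewrite in_itv/= => /dF ?; rewrite derive1E derive_val.
Qed.

Lemma itv_int_cst a b c : a <= b -> itv_int (cst c) a b = c * (b - a).
Proof.
move=> ab; rewrite /itv_int (@Rintegral_cst _ _ _ leb)//= lebesgue_measure_itv/= lte_fin.
by case: ltgtP ab => //= ->; rewrite subrr.
Qed.

Lemma le_itv_int f g a b :
  leb.-integrable `[a, b] (EFin \o f) -> leb.-integrable `[a, b] (EFin \o g) ->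
  (forall x, a <= x <= b -> f x <= g x) -> itv_int f a b <= itv_int g a b.
Proof. by move=> intf intg fg; apply: le_Rintegral => // x; rewrite /= in_itv; exact: fg. Qed.

Lemma ler_norm_itv_int f a b : leb.-integrable `[a, b] (EFin \o f) ->
  `|itv_int f a b| <= itv_int (fun x => `|f x|) a b.
Proof. by move=> ?; apply: le_normr_Rintegral. Qed.

Lemma ler_norm_itv_int_bound f a b c : a <= b ->
  leb.-integrable `[a, b] (EFin \o f) ->
  (forall x, a <= x <= b -> `|f x| <= c) -> `|itv_int f a b| <= c * (b - a).
Proof.
move=> ab intf fc; apply: le_trans (ler_norm_itv_int intf) _.
rewrite -(itv_int_cst c ab); apply: le_itv_int => //.
  exact: integrable_norm intf.
apply: cts_integrable => x _; exact: cst_continuous.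
Qed.

Lemma is_derive1_eq f (x df df' : R) :
  is_derive x (1 : R) f df -> df = df' -> is_derive x (1 : R) f df'.
Proof. by move=> + <-. Qed.

Lemma is_derive1_mul f g (x df dg : R) :
  is_derive x (1 : R) f df -> is_derive x (1 : R) g dg ->
  is_derive x (1 : R) (fun y => f y * g y) (f x * dg + g x * df).
Proof. by move=> hf hg; have := is_deriveM hf hg. Qed.

End IntervalIntegral.

(** * Negative powers of polynomials *)

Section Psi.
Context {R : realType}.
Implicit Types (a u v k : R).

(** The cap keeps the function continuous and, for [a >= 0], bounded by 1, so that integrability is
    automatic at every stage. *)
Definition psi a u : R := (Num.max 1 u) `^ (- a).

Lemma powR_anti a u v : 0 <= a -> 0 < u -> u <= v -> v `^ (- a) <= u `^ (- a).
Proof.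
move=> a0 u0 uv; have v0 := lt_le_trans u0 uv.
rewrite !powRN lef_pV2 ?posrE ?powR_gt0//.
by apply: ge0_ler_powR; rewrite ?nnegrE// ltW.
Qed.

Lemma max1_gt0 u : 0 < Num.max 1 u.
Proof. by rewrite lt_max ltr01. Qed.

Lemma psi_ge0 a u : 0 <= psi a u. Proof. exact: powR_ge0. Qed.

Lemma psi_le1 a u : 0 <= a -> psi a u <= 1.
Proof.
move=> a0; have -> : 1 = 1 `^ (- a) :> R by rewrite powR1.
by apply: powR_anti => //; rewrite le_max lexx.
Qed.

Lemma psi_anti a u v : 0 <= a -> u <= v -> psi a v <= psi a u.
Proof.
move=> a0 uv; apply: powR_anti => //; first exact: max1_gt0.
by rewrite ge_max !le_max lexx uv orbT.
Qed.

Lemma psi_small a u : u <= 1 -> psi a u = 1.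
Proof. by move=> u1; rewrite /psi max_l// powR1. Qed.

Lemma psi_large a u : 1 <= u -> psi a u = u `^ (- a).
Proof. by move=> u1; rewrite /psi max_r. Qed.

Lemma continuous_powR_pos (f : R -> R) (x b : R) : 0 < f x ->
  {for x, continuous f} -> {for x, continuous (fun y => f y `^ b)}.
Proof.
move=> fx cf; apply: (@continuous_comp _ _ _ f (fun z => z `^ b)) => //.
apply/differentiable_continuous/derivable1_diffP.
by have [] := is_derive1_powR b fx.
Qed.

Lemma continuous_psi a : continuous (psi a).
Proof.
move=> u; apply: (@continuous_powR_pos (Num.max 1)); first exact: max1_gt0.
apply: continuous_max; [exact: cst_continuous|exact: cvg_id].
Qed.

Lemma continuous_psi_horner a (p : {poly R}) (x : R) :
  {for x, continuous (fun y => psi a `|p.[y]|)}.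
Proof.
apply: (@continuous_comp _ _ _ (fun y => `|p.[y]|) (psi a)).
  apply: (@continuous_comp _ _ _ (horner p) Num.norm).
    exact: continuous_horner.
  exact: norm_continuous.
exact: continuous_psi.
Qed.

(** A smooth substitute for the integral of |y - x|^(-b), without singularity at x. The derivative
    of (y - x) w(y) is w (1 - b (y - x)^2 / A), which is at least (1 - b) w since (y - x)^2 <= A. So
    (1 - b) times the integral is at most F(1) - F(0), and |F| <= 3. *)
Lemma int_bump_le (b th x : R) : 0 <= b < 1 -> 0 < th -> `|x| <= 2 ->
  itv_int (fun y => (th ^+ 2 + (y - x) ^+ 2) `^ (- (b / 2))) 0 1 <= 6 / (1 - b).
Proof.
move=> /andP[b0 b1] th0 x2.
pose A (y : R) := th ^+ 2 + (y - x) ^+ 2.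
have A0 y : 0 < A y by rewrite ltr_wpDr ?sqr_ge0// exprn_gt0.
pose w y := A y `^ (- (b / 2)).
pose F y := (y - x) * w y.
pose f y := w y * (1 - b * ((y - x) ^+ 2 / A y)).
have dA (y : R) : is_derive y (1 : R) A (2 * (y - x)).
  have -> : A = horner ((th ^+ 2)%:P + ('X - x%:P) ^+ 2).
    by apply/funext => z; rewrite !hornerE.
  apply: is_derive_eq; rewrite derivD derivC deriv_exp derivXsubC !hornerE.
  by rewrite /=; ring.
have dF (y : R) : is_derive y (1 : R) F (f y).
  have dw : is_derive y (1 : R) w (2 * (y - x) * (- (b / 2) * A y `^ (- (b / 2) - 1))).
    have dp := is_derive1_powR (- (b / 2)) (A0 y).
    by apply: is_derive1_eq (is_derive1_comp dp (dA y)) _; rewrite mulrC.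
  have dx : is_derive y (1 : R) (fun z : R => z - x) 1.
    by apply: is_derive_eq; rewrite oppr0 addr0.
  apply: (is_derive1_eq (is_derive1_mul dx dw)).
  rewrite /f powRD; last by rewrite (gt_eqF (A0 y)) implybT.
  rewrite -/(w y) powR_inv1 ?(ltW (A0 y))//.
  by field; rewrite gt_eqF.
have cA (y : R) : {for y, continuous A}.
  by apply/differentiable_continuous/derivable1_diffP; case: (dA y).
have cw (y : R) : {for y, continuous w} by apply: continuous_powR_pos.
have cf (y : R) : {for y, continuous f}.
  apply: continuousM; first exact: cw.
  apply: continuousB; first exact: cst_continuous.
  apply: continuousM; first exact: cst_continuous.
  apply: continuousM; last by apply: continuousV; [rewrite gt_eqF|exact: cA].
  apply: (@continuous_comp _ _ _ (fun z => z - x) (fun z => z ^+ 2)).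
    by apply: continuousB; [exact: cvg_id|exact: cst_continuous].
  exact: exprn_continuous.
have w0 y : 0 <= w y by exact: powR_ge0.
have Fle y : `|y - x| <= 3 -> `|F y| <= 3.
  move=> yx; rewrite normrM (ger0_norm (w0 y)).
  (* For A >= 1 the weight is at most 1. For A < 1 the exponent b/2 may be raised to 1/2, and
     A^(-1/2) <= 1/|y - x| gives |F| <= 1. *)
  have [A1|A1] := leP 1 (A y).
    have : w y <= 1.
      have -> : 1 = 1 `^ (- (b / 2)) :> R by rewrite powR1.
      by apply: powR_anti => //; lra.
    by have := normr_ge0 (y - x); have := w0 y; nra.
  have wA : w y <= (A y) `^ (- (2^-1)).
    by rewrite /w; apply: ger_powR; [rewrite A0 ltW|lra].
  have [->|yx0] := eqVneq (y - x) 0; first by rewrite normr0 mul0r.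
  apply: (@le_trans _ _ 1); last by lra.
  rewrite -ler_pdivlMl ?normr_gt0// mulr1; apply: le_trans wA _.
  rewrite powRN powR12_sqrt ?(ltW (A0 y))// lef_pV2 ?posrE ?normr_gt0 ?sqrtr_gt0//.
  by rewrite -sqrtr_sqr ler_sqrt ?(ltW (A0 y))// lerDr sqr_ge0.
have h : (1 - b) * itv_int w 0 1 <= F 1 - F 0.
  rewrite -(@itv_int_FTC _ f)//.
  rewrite /itv_int -RintegralZl//; last by apply: cts_integrable => *; exact: cw.
  apply: le_itv_int => [||y _].
  - apply: cts_integrable => y _; apply: continuousM; [exact: cst_continuous|exact: cw].
  - by apply: cts_integrable => y _.
  - rewrite mulrC /f ler_wpM2l// lerD2l lerN2 ler_piMr// ler_pdivrMr// mul1r.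
    by rewrite lerDr sqr_ge0.
rewrite ler_pdivlMr ?subr_gt0// mulrC; apply: le_trans h _.
have := Fle 1; have := Fle 0.
move: x2; rewrite !ler_norml => /andP[x2 x2'] h0 h1.
have /andP[] := h0 ltac:(lra); have /andP[] := h1 ltac:(lra); lra.
Qed.
(** The scale th = c^(-1/e) satisfies c th^e = 1, hence max(1, c |u|^e) = c max(th, |u|)^e. The
    squared maximum is at least the mean (th^2 + u^2) / 2, and the factor 2 absorbs 2^(a e / 2). *)
Lemma psi_monomial_le (a c u : R) (e : nat) : (0 < e)%N -> 0 < c -> 0 <= a ->
  a * e%:R < 1 ->
  psi a (c * `|u| ^+ e) <=
  2 * c `^ (- a) * ((c `^ (- e%:R^-1)) ^+ 2 + u ^+ 2) `^ (- (a * e%:R / 2)).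
Proof.
move=> e0 c0 a0 ae1; set th := c `^ (- e%:R^-1).
have th0 : 0 < th by exact: powR_gt0.
have er0 : e%:R != 0 :> R by rewrite pnatr_eq0 -lt0n.
have cth : c * th ^+ e = 1.
  rewrite -powR_mulrn ?(ltW th0)// /th -powRrM mulNr mulVf//.
  rewrite powR_inv1 ?(ltW c0)//.
  by rewrite mulfV ?gt_eqF.
have S0 : 0 < th ^+ 2 + u ^+ 2 by rewrite ltr_wpDr ?sqr_ge0 ?exprn_gt0.
pose S := (th ^+ 2 + u ^+ 2) / 2.
have Sgt0 : 0 < S by rewrite divr_gt0.
have key : c * S `^ (e%:R / 2) <= Num.max 1 (c * `|u| ^+ e).
  pose m : R := Num.max th `|u|.
  have m0 : 0 <= m by rewrite le_max (ltW th0).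
  have -> : Num.max 1 (c * `|u| ^+ e) = c * m ^+ e.
    rewrite /m -cth; case: (leP th `|u|) => hu.
      by rewrite max_r// ler_pM2l// lerXn2r// ?nnegrE// ltW.
    by rewrite max_l// ler_pM2l// lerXn2r// ?nnegrE// ltW.
  rewrite ler_pM2l//.
  have -> : m ^+ e = (m ^+ 2) `^ (e%:R / 2).
    rewrite -[m ^+ 2]powR_mulrn// -powRrM mulrCA mulfV ?mulr1//.
    by rewrite powR_mulrn.
  apply: ge0_ler_powR; rewrite ?nnegrE ?sqr_ge0 ?(ltW Sgt0)//.
  rewrite /S ler_pdivrMr// mulr_natr mulr2n -[u ^+ 2]real_normK ?num_real//.
  by apply: lerD; rewrite lerXn2r ?nnegrE ?(ltW th0)// /m le_max lexx ?orbT.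
have Se0 : 0 < S `^ (e%:R / 2) by exact: powR_gt0.
apply: le_trans (powR_anti a0 (mulr_gt0 c0 Se0) key) _.
rewrite powRM ?(ltW c0) ?(ltW Se0)// -powRrM mulrN (mulrC 2) -[leRHS]mulrA.
apply: ler_wpM2l; first exact: powR_ge0.
have -> : e%:R / 2 * a = a * e%:R / 2 by ring.
rewrite /S powRM ?(ltW S0)// mulrC; apply: ler_wpM2r.
  exact: powR_ge0.
rewrite -powR_inv1// -powRrM mulN1r opprK.
apply: ler1_powR; first by rewrite ler1n.
have : 0 <= a * e%:R by rewrite mulr_ge0.
rewrite powR_inv1 ?ler0n//; lra.
Qed.

Lemma int_psi_monomial_le (a c x : R) (e : nat) : (0 < e)%N -> 0 < c ->
  0 <= a -> a * e%:R < 1 -> `|x| <= 2 ->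
  itv_int (fun y => psi a (c * `|y - x| ^+ e)) 0 1 <=
  12 / (1 - a * e%:R) * c `^ (- a).
Proof.
move=> e0 c0 a0 ae1 x2.
pose th := c `^ (- e%:R^-1); have th0 : 0 < th by exact: powR_gt0.
pose w (y : R) := (th ^+ 2 + (y - x) ^+ 2) `^ (- (a * e%:R / 2)).
have cw (y : R) : {for y, continuous w}.
  apply: continuous_powR_pos; first by rewrite ltr_wpDr ?sqr_ge0 ?exprn_gt0.
  apply: continuousD; first exact: cst_continuous.
  apply: (@continuous_comp _ _ _ (fun z => z - x) (fun z => z ^+ 2)).
    by apply: continuousB; [exact: cvg_id|exact: cst_continuous].
  exact: exprn_continuous.
have ae : 0 <= a * e%:R < 1 by rewrite mulr_ge0.
have iw : lebesgue_measure.-integrable `[0, 1] (EFin \o w).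
  by apply: cts_integrable => y _; exact: cw.
apply: (@le_trans _ _ (2 * c `^ (- a) * itv_int w 0 1)).
  rewrite /itv_int -RintegralZl//; apply: le_itv_int => [||y _].
  - apply: cts_integrable => y _.
    apply: (@continuous_comp _ _ _ (fun y => c * `|y - x| ^+ e) (psi a)).
      apply: continuousM; first exact: cst_continuous.
      apply: (@continuous_comp _ _ _ (fun z => `|z - x|) (fun z => z ^+ e)).
        apply: (@continuous_comp _ _ _ (fun z => z - x) Num.norm).
          by apply: continuousB; [exact: cvg_id|exact: cst_continuous].
        exact: norm_continuous.
      exact: exprn_continuous.
    exact: continuous_psi.
  - apply: cts_integrable => y _; apply: continuousM; last exact: cw.
    exact: cst_continuous.
  - exact: psi_monomial_le.
rewrite mulrC -mulrA; have h := int_bump_le ae th0 x2.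
apply: (@le_trans _ _ (6 / (1 - a * e%:R) * (2 * c `^ (- a)))).
  apply: ler_wpM2r; last exact: h.
  by rewrite mulr_ge0 ?powR_ge0.
rewrite le_eqVlt; apply/orP; left; apply/eqP; ring.
Qed.

(** A smallest factor works. It reduces a product of distances to a power of the distance to a
    single point. *)
Lemma exists_expr_size_le_prod (T : eqType) (s : seq T) (F : T -> R) :
  (0 < size s)%N -> (forall x, 0 <= F x) ->
  exists2 x, x \in s & F x ^+ size s <= \prod_(x <- s) F x.
Proof.
move=> + F0; elim: s => //= x s IH _.
case: s IH => [_|x' s IH].
  by exists x; rewrite ?inE// big_seq1 expr1.
have [//|z zs hz] := IH.
rewrite big_cons; have [xz|zx] := leP (F x) (F z).
  exists x; rewrite ?inE ?eqxx// exprS; apply: ler_wpM2l => //.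
  by apply: le_trans hz; rewrite lerXn2r ?nnegrE.
exists z; first by rewrite inE zs orbT.
by rewrite exprS; apply: ler_pM => //; [rewrite exprn_ge0|exact: ltW].
Qed.

Lemma itv_int_sum (T : Type) (s : seq T) (F : T -> R -> R) (b : R) :
  (forall t, lebesgue_measure.-integrable `[0, b] (EFin \o F t)) ->
  itv_int (fun y => \sum_(t <- s) F t y) 0 b = \sum_(t <- s) itv_int (F t) 0 b.
Proof.
move=> iF; elim: s => [|t s IH].
  rewrite big_nil /itv_int; under eq_Rintegral do rewrite big_nil.
  by rewrite Rintegral_cst// mul0r.
rewrite big_cons -IH /itv_int -RintegralD//.
  by apply: eq_Rintegral => y _; rewrite big_cons.
rewrite [X in _.-integrable _ X](_ : _ =
    (fun y => \sum_(t <- s) (EFin \o F t) y)%E); last first.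
  by apply/funext => y/=; rewrite sumEFin.
exact: integrable_sum.
Qed.

(** At each y the nearest of the [r] points x gives |p(y)| >= c |y - x|^r, so the integrand is at
    most the sum over all points of the one-point integrands, which removes the dependence of x on
    y. Here 48 is 12 times the 4 lost in c^(-a). *)
Lemma int_psi_horner_le (a : R) (r i : nat) (p : {poly R}) (t : R) :
  (0 < r)%N -> (size p <= r.+1)%N -> 0 <= a -> a * r%:R < 1 -> 0 <= t <= 1 ->
  itv_int (fun y => psi a `|p.[y]|) 0 t <=
  48 * r%:R / (1 - a * r%:R) * psi a `|p`_i|.
Proof.
move=> r0 sp a0 ar1 /andP[t0 t1].
have r1 : 1 <= r%:R :> R by rewrite ler1n.
have D1 : 1 <= 1 / (1 - a * r%:R).
  rewrite ler_pdivlMr ?subr_gt0// mul1r gerBl mulr_ge0//; lra.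
have a1 : a <= 1 by apply: ltW; apply: le_lt_trans ar1; rewrite ler_peMr.
have ipsi b : lebesgue_measure.-integrable `[0, b] (EFin \o (fun y => psi a `|p.[y]|)).
  by apply: cts_integrable => y _; exact: continuous_psi_horner.
apply: (@le_trans _ _ (itv_int (fun y => psi a `|p.[y]|) 0 1)).
  rewrite (@itv_int_split _ _ 0 1 t) ?t0// lerDl.
  by apply: Rintegral_ge0 => y _; exact: psi_ge0.
(* A small coefficient needs only the trivial bound: [psi] is 1 on the right and the constant is at
   least 1. *)
have [M1|M1] := leP `|p`_i| 1.
  rewrite [psi a `|p`_i|]psi_small// mulr1.
  apply: (@le_trans _ _ 1); last first.
    by move: D1; rewrite mul1r; set q := _^-1 => q1; nra.
  rewrite [leRHS](_ : _ = itv_int (cst 1) 0 1); last first.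
    by rewrite itv_int_cst ?subr0 ?mulr1.
  apply: le_itv_int => //.
    by apply: cts_integrable => y _; exact: cst_continuous.
  by move=> y _; exact: psi_le1.
have [xs [sx x2 hx]] := poly_lower_bound sp.
pose c : R := `|p`_i| / 4 ^+ r.
have r40 : 0 < 4 ^+ r :> R by rewrite exprn_gt0.
have c0 : 0 < c by rewrite divr_gt0//; lra.
pose G (x y : R) : R := psi a (c * `|y - x| ^+ r).
have iG (x b : R) : lebesgue_measure.-integrable `[0, b] (EFin \o G x).
  apply: cts_integrable => y _.
  apply: (@continuous_comp _ _ _ (fun y => c * `|y - x| ^+ r) (psi a)).
    apply: continuousM; first exact: cst_continuous.
    apply: (@continuous_comp _ _ _ (fun z => `|z - x|) (fun z => z ^+ r)).
      apply: (@continuous_comp _ _ _ (fun z => z - x) Num.norm).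
        by apply: continuousB; [exact: cvg_id|exact: cst_continuous].
      exact: norm_continuous.
    exact: exprn_continuous.
  exact: continuous_psi.
apply: (@le_trans _ _ (\sum_(x <- xs) itv_int (G x) 0 1)).
  rewrite -itv_int_sum//; apply: le_itv_int => //.
    rewrite [X in _.-integrable _ X](_ : _ =
      (fun y => \sum_(x <- xs) (EFin \o G x) y)%E); last first.
      by apply/funext => y/=; rewrite sumEFin.
    exact: integrable_sum.
  move=> y y01.
  have [||x xin hxp] := @exists_expr_size_le_prod _ xs (fun x => `|y - x|) => //.
    by rewrite sx.
  apply: (@le_trans _ _ (G x y)).
    apply: psi_anti => //; rewrite /c mulrAC ler_pdivrMr// mulrC.
    rewrite mulrC [leRHS]mulrC; apply: le_trans (hx i y y01).
    by apply: ler_wpM2l => //; rewrite -sx.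
  rewrite (big_rem x)//= lerDl sumr_ge0// => z _; exact: psi_ge0.
apply: (@le_trans _ _ (\sum_(x <- xs) (12 / (1 - a * r%:R) * c `^ (- a)))).
  rewrite !big_seq; apply: ler_sum => x xin.
  by apply: int_psi_monomial_le => //; move/allP: x2; apply.
rewrite big_const_seq count_predT iter_addr_0 sx.
rewrite psi_large ?(ltW M1)//.
(* The factor (4^r)^a = 4^(a r) is at most 4 because a r < 1. *)
have cM : c `^ (- a) <= 4 * `|p`_i| `^ (- a).
  rewrite /c powRM ?invr_ge0 ?(ltW r40)// mulrC; apply: ler_wpM2r.
    exact: powR_ge0.
  rewrite -powR_inv1 ?(ltW r40)// -powRrM mulN1r opprK -powR_mulrn//.
  rewrite -powRrM mulrC; apply: ler1_powR; last exact: ltW.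
  by rewrite ler1n.
rewrite -[leLHS]mulr_natr.
have -> : 48 * r%:R / (1 - a * r%:R) * `|p`_i| `^ (- a) =
  12 / (1 - a * r%:R) * (4 * `|p`_i| `^ (- a)) * r%:R by ring.
apply: ler_wpM2r; first lra.
by apply: ler_wpM2l => //; rewrite divr_ge0// subr_ge0 ltW.
Qed.

End Psi.

(** * Oscillatory integrals in one variable *)

Section Splitting.
Context {R : realType}.
Variable I : R -> R -> R.
Hypothesis I_ge0 : forall a b, 0 <= I a b.
Hypothesis I_split : forall a c b, a <= c <= b -> I a b <= I a c + I c b.

(** At a root c the polynomial is w1 (y - c), and on either side of c a constant sign of w1 forces a
    constant sign of w; without roots the intermediate value theorem gives the sign. Both halves are
    treated with the same degree bound, whence 2^N pieces. *)
Lemma split_at_roots (N : nat) (w : {poly R}) (K A B : R) :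
  (size w <= N.+1)%N -> A <= B ->
  (forall a b, A <= a -> a <= b -> b <= B ->
     (forall y, a <= y <= b -> 0 <= w.[y]) \/
     (forall y, a <= y <= b -> w.[y] <= 0) -> I a b <= K) ->
  I A B <= 2 ^+ N * K.
Proof.
elim: N w A B => [|N IH] w A B sw AB hK.
  rewrite expr0 mul1r; apply: hK => //.
  have [w0|w0] := leP 0 w`_0; [left|right] => y _;
    by rewrite (size1_polyC sw) hornerC// ltW.
have [[c cAB rc]|noroot] := pselect (exists2 c, A <= c <= B & root w c).
  have /andP[Ac cB] := cAB.
  have [w1 wE] := factor_theorem _ _ rc.
  have sw1 : (size w1 <= N.+1)%N.
    have [w10|w10] := eqVneq w1 0; first by rewrite w10 size_poly0.
    by move: sw; rewrite wE size_Mmonic ?monicXsubC// size_XsubC addn2.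
  have wyE y : w.[y] = w1.[y] * (y - c) by rewrite wE hornerM hornerXsubC.
  apply: le_trans (I_split cAB) _.
  rewrite exprS -mulrA mulr2n mulrDl mul1r; apply: lerD.
    apply: (IH w1) => // a b Aa ab bc h; apply: hK => //; first exact: le_trans cB.
    case: h => h; [right|left] => y yab; have := h y yab; rewrite wyE => hy;
      have : y <= c by case/andP: yab => _ /le_trans; apply.
      by move=> yc; rewrite mulr_ge0_le0// subr_le0.
    by move=> yc; rewrite mulr_le0// subr_le0.
  apply: (IH w1) => // a b Aa ab bc h; apply: hK => //; first exact: le_trans Aa.
  case: h => h; [left|right] => y yab; have := h y yab; rewrite wyE => hy;
    have : c <= y by case/andP: yab => /(le_trans Aa).
    by move=> yc; rewrite mulr_ge0// subr_ge0.
  by move=> yc; rewrite mulr_le0_ge0// subr_ge0.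
have hI : I A B <= K.
  apply: hK => //; have [wA|wA] := leP 0 w.[A]; [left|right] => y /andP[Ay yB].
    rewrite leNgt; apply/negP => wy; apply: noroot.
    have [||c cAy] := @poly_ivt _ (- w) A y; rewrite ?hornerN ?oppr_le0 ?oppr_ge0 ?wA ?(ltW wy)//.
    rewrite rootN => rc; exists c => //; move: cAy => /andP[-> /le_trans]; exact.
  rewrite leNgt; apply/negP => wy; apply: noroot.
  have [||c cAy rc] := @poly_ivt _ w A y; rewrite ?(ltW wA) ?(ltW wy)//.
  exists c => //; move: cAy => /andP[-> /le_trans]; exact.
have K0 : 0 <= K := le_trans (I_ge0 A B) hI.
by apply: le_trans hI _; rewrite ler_peMl// exprn_ege1 ?ler1n.
Qed.

Hypothesis I_le : forall a b, a <= b -> I a b <= b - a.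

(** A window of radius k around each point is cut out and estimated by its length. The summand 2k on
    the left closes the induction: the window costs 2k, so the claim for the interval is the sum of
    the claims for the two remaining parts. *)
Lemma split_near_points (xs : seq R) (k K A B : R) : 0 <= k -> 0 <= K -> A <= B ->
  (forall a b, A <= a -> a <= b -> b <= B ->
     (forall y x, a <= y <= b -> x \in xs -> k <= `|y - x|) -> I a b <= K) ->
  I A B + 2 * k <= 2 ^+ size xs * (K + 2 * k).
Proof.
move=> k0 K0; elim: xs A B => [|x xs IH] A B AB hK.
  by rewrite expr0 mul1r lerD2r; apply: hK.
have pw : K + 2 * k <= 2 ^+ size xs * (K + 2 * k).
  by rewrite ler_peMl ?exprn_ege1 ?ler1n//; lra.
rewrite /= exprS -mulrA; set Z := 2 ^+ size xs * _ in pw IH *.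
pose c1 := Num.max A (Num.min B (x - k)).
pose c2 := Num.max A (Num.min B (x + k)).
have Ac1 : A <= c1 by rewrite le_max lexx.
have c2B : c2 <= B by rewrite ge_max AB ge_min lexx.
have c12 : c1 <= c2.
  rewrite /c1 /c2; case: (leP B (x - k)); case: (leP B (x + k)) => h1 h2;
    rewrite ge_max !le_max lexx/=; apply/orP; right; lra.
have c21 : c2 - c1 <= 2 * k.
  rewrite /c1 /c2; case: (leP B (x - k)) => h1; case: (leP B (x + k)) => h2;
    rewrite ?(max_r AB); case: (leP A (x - k)) => h3; case: (leP A (x + k)) => h4; lra.
have left : I A c1 + 2 * k <= Z.
  (* The clamped window may reach [A]. Then the left part is a point, perhaps closer than k to [x],
     but [I A A] vanishes. *)
  have [c1A|c1A] := eqVneq c1 A.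
    rewrite c1A; have := I_le (lexx A); have := I_ge0 A A; rewrite subrr; lra.
  have c1x : c1 <= x - k.
    move: c1A; rewrite /c1; case: (leP A) => [_ _|_]; first by rewrite ge_min lexx orbT.
    by rewrite eqxx.
  apply: IH => // a b Aa ab bc h; apply: hK => //.
    by rewrite (le_trans bc)// (le_trans c12).
  move=> y z /[dup] yab /andP[ay yb]; rewrite inE => /predU1P[->|]; last exact: h.
  by rewrite ler0_norm; lra.
have right : I c2 B + 2 * k <= Z.
  have [c2E|c2E] := eqVneq c2 B.
    rewrite c2E; have := I_le (lexx B); have := I_ge0 B B; rewrite subrr; lra.
  have c1x : x + k <= c2.
    move: c2E; rewrite /c2; case: (leP B (x + k)) => [|h _]; last by rewrite le_max lexx orbT.
    by rewrite max_r// eqxx.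
  apply: IH => // a b Aa ab bc h; apply: hK => //.
    by rewrite (le_trans _ Aa)// (le_trans Ac1).
  move=> y z /[dup] yab /andP[ay yb]; rewrite inE => /predU1P[->|]; last exact: h.
  by rewrite ger0_norm; lra.
have c1B : A <= c1 <= B by rewrite Ac1 (le_trans c12).
have c2B' : c1 <= c2 <= B by rewrite c12.
have := I_split c1B; have := I_split c2B'; have := I_le c12; lra.
Qed.

End Splitting.

(** * Van der Corput estimates for polynomial phases *)

Section VanDerCorput.
Context {R : realType}.
Local Notation leb := (@lebesgue_measure R).
Implicit Types (P : {poly R}).

(** A cosine suffices: any phase shift can be put into the constant coefficient of [P]. *)
Definition osc P (a b : R) : R := `|itv_int (fun y => cos P.[y]) a b|.

Lemma continuous_cos_horner P (x : R) : {for x, continuous (fun y => cos P.[y])}.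
Proof.
apply: (@continuous_comp _ _ _ (horner P) cos); first exact: continuous_horner.
exact: continuous_cos.
Qed.

Lemma continuous_sin_horner P (x : R) : {for x, continuous (fun y => sin P.[y])}.
Proof.
apply: (@continuous_comp _ _ _ (horner P) sin); first exact: continuous_horner.
exact: continuous_sin.
Qed.

Lemma cos_horner_integrable P (a b : R) :
  leb.-integrable `[a, b] (EFin \o (fun y => cos P.[y])).
Proof. by apply: cts_integrable => y _; exact: continuous_cos_horner. Qed.

Lemma osc_le P (a b : R) : a <= b -> osc P a b <= b - a.
Proof.
move=> ab; rewrite -[leRHS]mul1r; apply: ler_norm_itv_int_bound => //.
  exact: cos_horner_integrable.
by move=> x _; rewrite ler_norml cos_geN1 cos_le1.
Qed.

Lemma osc_split P (a c b : R) : a <= c <= b -> osc P a b <= osc P a c + osc P c b.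
Proof.
move=> acb; rewrite /osc (itv_int_split acb) ?ler_normD//.
exact: cos_horner_integrable.
Qed.

(** Integration by parts: (sin P / P')' = cos P - sin P * P'' / P'^2. The boundary values give 2 /
    dl. Since P'' has constant sign, the integral of |P''| / P'^2 is a difference of two values of 1
    / P', again at most 2 / dl. *)
Lemma osc_monotone_derivative P (a b dl : R) : a <= b -> 0 < dl ->
  (forall y, a <= y <= b -> dl <= `|P^`().[y]|) ->
  (forall y, a <= y <= b -> 0 <= P^`(2).[y]) \/
  (forall y, a <= y <= b -> P^`(2).[y] <= 0) ->
  osc P a b <= 4 / dl.
Proof.
move=> ab dl0 hq hsgn; set q := P^`() in hq.
have q0 y : a <= y <= b -> q.[y] != 0.
  by move=> /hq h; rewrite -normr_gt0; exact: lt_le_trans h.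
have qE : P^`(2) = q^`() by rewrite derivSn derivn1.
rewrite {}qE in hsgn.
have dV (y : R) : a <= y <= b ->
    is_derive y (1 : R) (fun z => (q.[z])^-1) (- (q^`().[y] / q.[y] ^+ 2)).
  move=> yab; have := is_deriveV (q0 _ yab) (is_derive_poly q y).
  by move/is_derive1_eq; apply; rewrite /GRing.scale/= mulNr mulrC.
have dS (y : R) : is_derive y (1 : R) (fun z => sin P.[z]) (cos P.[y] * q.[y]).
  exact: (is_derive1_comp (is_derive_sin P.[y]) (is_derive_poly P y)).
pose g y := q^`().[y] / q.[y] ^+ 2.
have cq (p : {poly R}) (y : R) : {for y, continuous (horner p)} by exact: continuous_horner.
have cg (y : R) : a <= y <= b -> {for y, continuous g}.
  move=> yab; apply: continuousM; first exact: cq.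
  apply: (@continuousV _ _ (fun z => q.[z] ^+ 2)); first by rewrite expf_neq0// q0.
  apply: (@continuous_comp _ _ _ (horner q) (fun z => z ^+ 2)); first exact: cq.
  exact: exprn_continuous.
have Vb y : a <= y <= b -> `|(q.[y])^-1| <= dl^-1.
  by move=> yab; rewrite normfV lef_pV2 ?posrE ?normr_gt0 ?q0// hq.
have ig : leb.-integrable `[a, b] (EFin \o g) by exact: cts_integrable.
have aab : a <= a <= b by rewrite lexx.
have bab : a <= b <= b by rewrite lexx ab.
have intg : itv_int g a b = (q.[a])^-1 - (q.[b])^-1.
  have := @itv_int_FTC _ (fun y => - g y) (fun z => (q.[z])^-1) a b ab dV.
  rewrite /itv_int.
  under eq_Rintegral do rewrite -mulN1r.
  rewrite RintegralZl// mulN1r => h; rewrite -[LHS]opprK h ?opprB// => y yab.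
  by apply: continuousN; exact: cg.
have absg : itv_int (fun y => `|g y|) a b <= 2 / dl.
  have hg s : `|s| = 1 -> (forall y, a <= y <= b -> `|g y| = s * g y) ->
      itv_int (fun y => `|g y|) a b <= 2 / dl.
    move=> s1 hs.
    have -> : itv_int (fun y => `|g y|) a b = itv_int (fun y => s * g y) a b.
      by apply: eq_Rintegral => y; rewrite inE/= in_itv/=; exact: hs.
    rewrite /itv_int RintegralZl//; apply: le_trans (ler_norm _) _.
    rewrite normrM s1 mul1r -/(itv_int g a b) intg.
    apply: le_trans (ler_normB _ _) _; have := Vb _ aab; have := Vb _ bab; lra.
  case: hsgn => h.
    apply: (hg 1) => [|y yab]; first by rewrite normr1.
    by rewrite mul1r ger0_norm// divr_ge0 ?sqr_ge0// h.
  apply: (hg (-1)) => [|y yab]; first by rewrite normrN1.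
  by rewrite mulN1r ler0_norm// mulr_le0_ge0 ?invr_ge0 ?sqr_ge0// h.
pose u y := sin P.[y] * g y.
have cu (y : R) : a <= y <= b -> {for y, continuous u}.
  by move=> yab; apply: continuousM; [exact: continuous_sin_horner|exact: cg].
have iu : leb.-integrable `[a, b] (EFin \o u) by exact: cts_integrable.
pose F z := sin P.[z] * (q.[z])^-1.
have FTC : itv_int (fun y => cos P.[y] - u y) a b = F b - F a.
  apply: itv_int_FTC => // y yab.
    apply: is_derive1_eq (is_derive1_mul (dS y) (dV y yab)) _.
    by rewrite mulrN addrC mulrCA mulVf ?mulr1 ?q0.
  apply: continuousB; [exact: continuous_cos_horner|exact: cu].
have sb (x : R) : `|sin x| <= 1 by rewrite ler_norml sin_geN1 sin_le1.
have Fb y : a <= y <= b -> `|F y| <= dl^-1.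
  move=> yab; rewrite normrM -[leRHS]mul1r; apply: ler_pM => //; exact: Vb.
have ub : `|itv_int u a b| <= 2 / dl.
  apply: le_trans (ler_norm_itv_int iu) _; apply: le_trans absg.
  apply: le_itv_int => [||y yab].
  - exact: integrable_norm iu.
  - exact: integrable_norm ig.
  - by rewrite normrM ler_piMl.
move: FTC; rewrite /itv_int RintegralB//; last exact: cos_horner_integrable.
move=> /(canRL (subrK _)) E; rewrite /osc /itv_int E.
apply: le_trans (ler_normD _ _) _.
have := ler_normB (F b) (F a); have := Fb _ aab; have := Fb _ bab.
rewrite -/(itv_int u a b); lra.
Qed.

Lemma size_deriv_le P : (size P^`() <= (size P).-1)%N.
Proof.
have [->|P0] := eqVneq P 0; first by rewrite deriv0 size_poly0.
by rewrite -ltnS prednK ?lt_size_deriv// lt0n size_poly_eq0.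
Qed.

(** Monotonicity of P' is obtained by cutting at the roots of P''. *)
Lemma osc_derivative_bound (m : nat) P (a b dl : R) : (size P <= m.+1)%N ->
  a <= b -> 0 < dl -> (forall y, a <= y <= b -> dl <= `|P^`().[y]|) ->
  osc P a b <= 2 ^+ m * (4 / dl).
Proof.
move=> sP ab dl0 hq; apply: (@split_at_roots _ (osc P) _ _ _ P^`(2)) => //.
- by move=> a0 b0; exact: normr_ge0.
- exact: osc_split.
- rewrite derivSn derivn1; apply: leq_trans sP.
  by apply: leq_trans (size_deriv_le _) _; rewrite (leq_trans (leq_pred _))// (leq_trans (size_deriv_le _))// leq_pred.
- move=> a0 b0 aa0 ab0 bb0; apply: osc_monotone_derivative => // y /andP[ay yb].
  by apply: hq; rewrite (le_trans aa0)//= (le_trans yb).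
Qed.

Lemma expr_size_le_prod (T : eqType) (s : seq T) (F : T -> R) (k : R) : 0 <= k ->
  (forall x, x \in s -> k <= F x) -> k ^+ size s <= \prod_(x <- s) F x.
Proof.
move=> k0; elim: s => [|x s IH] hF; first by rewrite big_nil expr0.
rewrite big_cons exprS; apply: ler_pM => //; first by rewrite exprn_ge0.
  by apply: hF; rewrite inE eqxx.
by apply: IH => z zs; apply: hF; rewrite inE zs orbT.
Qed.

(** 2^m bounds the number of pieces left after removing the windows around the points attached to
    P'. Each piece contributes 8^m, that is 2^m from the roots of P'' times 4^m from 4 / dl, and the
    windows contribute 2, all in units of M^(-1/m). *)
Definition vdc_const (m : nat) : R := 2 ^+ m * (8 ^+ m + 2).

Lemma vdc_const_ge1 m : 1 <= vdc_const m.
Proof.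
have h2 : 1 <= 2 ^+ m :> R by rewrite exprn_ege1 ?ler1n.
have h8 : 1 <= 8 ^+ m :> R by rewrite exprn_ege1 ?ler1n.
rewrite /vdc_const; nra.
Qed.

Lemma osc_coef_le (m i : nat) P (al t : R) : (0 < m)%N -> (size P <= m.+1)%N ->
  (0 < i)%N -> 0 <= al -> al <= m%:R^-1 -> 0 <= t <= 1 ->
  osc P 0 t <= vdc_const m * psi al `|P`_i|.
Proof.
move=> m0 sP i0 al0 alm /andP[t0 t1].
pose M : R := `|P`_i|; rewrite -/M.
have [M1|M1] := leP M 1.
  rewrite psi_small// mulr1; apply: le_trans (osc_le _ t0) _.
  by rewrite subr0; apply: le_trans t1 _; exact: vdc_const_ge1.
have M0 : 0 < M by lra.
rewrite psi_large ?(ltW M1)//.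
(* This radius balances the window length k against 1 / (M k^(m-1)), the size of 1 / |P'| at
   distance k. *)
pose k := M `^ (- m%:R^-1).
have k0 : 0 < k by exact: powR_gt0.
(* As M > 1, lowering the exponent from 1/m to [al] only weakens the bound. *)
have kle : k <= M `^ (- al) by apply: ler_powR; [exact: ltW|rewrite lerN2].
apply: (@le_trans _ _ (vdc_const m * k)); last first.
  by apply: ler_wpM2l => //; have := vdc_const_ge1 m; lra.
have Mk : M * k ^+ m.-1 = k^-1.
  apply: (mulIf (lt0r_neq0 k0)); rewrite mulVf ?gt_eqF// -mulrA -exprSr prednK//.
  rewrite -powR_mulrn ?(ltW k0)// -powRrM mulNr mulVf ?pnatr_eq0 -?lt0n//.
  by rewrite powR_inv1 ?(ltW M0)// mulfV ?gt_eqF.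
have sq : (size P^`() <= m.-1.+1)%N.
  rewrite prednK//; apply: leq_trans (size_deriv_le _) _.
  by rewrite -ltnS; case: (size P) sP.
have [xs [sx _ hx]] := poly_lower_bound sq.
pose dl := k^-1 / 4 ^+ m.-1.
have dl0 : 0 < dl by rewrite divr_gt0 ?invr_gt0 ?exprn_gt0.
have h := @split_near_points _ (osc P) (fun a b => normr_ge0 _) (@osc_split P)
  (osc_le P) xs k (2 ^+ m * (4 / dl)) 0 t (ltW k0) _ t0.
have K0 : 0 <= 2 ^+ m * (4 / dl) by rewrite mulr_ge0 ?exprn_ge0//
  divr_ge0// ltW.
have {}h := h K0.
have : osc P 0 t + 2 * k <= 2 ^+ size xs * (2 ^+ m * (4 / dl) + 2 * k).
  apply: h => a b a0 ab bt hav; apply: osc_derivative_bound => // y yab.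
  have y01 : 0 <= y <= 1 by case/andP: yab => ay yb; apply/andP; split; lra.
  have := hx i.-1 y y01; rewrite coef_deriv prednK// => hh.
  rewrite /dl ler_pdivrMr ?exprn_gt0// mulrC; apply: le_trans hh.
  rewrite -Mk; apply: ler_pM; rewrite ?(ltW M0) ?exprn_ge0 ?(ltW k0)//.
    by rewrite normrMn -mulr_natr -[leLHS]mulr1; apply: ler_pM; rewrite ?(ltW M0) ?ler1n.
  rewrite -sx; apply: expr_size_le_prod; first exact: ltW.
  by move=> x; exact: hav.
move=> H; have : osc P 0 t <= 2 ^+ size xs * (2 ^+ m * (4 / dl) + 2 * k) by lra.
move=> /le_trans; apply; rewrite sx.
have -> : 4 / dl = 4 ^+ m * k.
  rewrite /dl invf_div invrK mulrA; congr (_ * _).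
  by rewrite -exprS prednK.
rewrite mulrA -exprMn -natrM -mulrDl mulrA.
apply: ler_wpM2r; first exact: ltW.
apply: ler_wpM2r; first by rewrite addr_ge0 ?exprn_ge0.
by apply: ler_weXn2l; [rewrite ler1n|exact: leq_pred].
Qed.

End VanDerCorput.

(** * Densities of bounded variation *)

Section AffineChange.
Context {R : realType}.
Local Notation leb := (@lebesgue_measure R).

Definition affine (a l : R) (y : measurableTypeR R) : measurableTypeR R := a + l * y.

Lemma measurable_affine (a l : R) : measurable_fun setT (affine a l).
Proof. by apply: measurable_funD => //; exact: measurable_funM. Qed.

Definition affine_image (a l : R) : {measure set (measurableTypeR R) -> \bar R} :=
  measure_function_pushforward__canonical__measure_function_Measure leb
    (measurable_affine a l).

Lemma lebesgue_measure_affine (a l : R) (l0 : 0 < l) (A : set (measurableTypeR R)) :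
  measurable A -> leb A = mscale (NngNum (ltW l0)) (affine_image a l) A.
Proof.
apply: lebesgue_measure_unique => _ [[b c] _ <-].
rewrite [RHS](_ : _ = l%:E * leb (affine a l @^-1` `]b, c]))%E//.
rewrite (_ : _ @^-1` _ = `](b - a) / l, (c - a) / l]%classic); last first.
  apply/seteqP; split => y /=; rewrite /affine !in_itv/= => /andP[h1 h2].
    by rewrite ltr_pdivrMr// ler_pdivlMr// ltrBlDl lerBrDl mulrC h1.
  move: h1 h2; rewrite ltr_pdivrMr// ler_pdivlMr// ltrBlDl lerBrDl mulrC => ->.
  by [].
rewrite !lebesgue_measure_itv/= !lte_fin ltr_pM2r ?invr_gt0// ltrD2r.
case: ifP => _; last by rewrite mule0.
by rewrite -!EFinB -EFinM; congr (_%:E); field; rewrite gt_eqF.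
Qed.

Lemma ge0_integral_affine (a l : R) (f : R -> \bar R) : 0 < l ->
  measurable_fun [set: measurableTypeR R] f -> (forall x, (0 <= f x)%E) ->
  (\int[leb]_x f x = l%:E * \int[leb]_y f (affine a l y))%E.
Proof.
move=> l0 mf f0.
rewrite (@eq_measure_integral _ _ _ setT
  (mscale (NngNum (ltW l0)) (affine_image a l))); last first.
  by move=> A mA _; exact: lebesgue_measure_affine.
rewrite ge0_integral_mscale//; congr (_ * _)%E.
by rewrite ge0_integral_pushforward//; exact: measurable_affine.
Qed.

Lemma integral_affine (a l : R) (f : R -> \bar R) : 0 < l ->
  measurable_fun [set: measurableTypeR R] f ->
  leb.-integrable setT f ->
  (\int[leb]_x f x = l%:E * \int[leb]_y f (affine a l y))%E.
Proof.
move=> l0 mf intf.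
have mfp : measurable_fun setT f^\+%E by exact: measurable_funepos.
have mfn : measurable_fun setT f^\-%E by exact: measurable_funeneg.
have hp := ge0_integral_affine a l0 mfp (fun x => funepos_ge0 f x).
have hn := ge0_integral_affine a l0 mfn (fun x => funeneg_ge0 f x).
pose X := (\int[leb]_y f^\+ (affine a l y))%E.
pose Y := (\int[leb]_y f^\- (affine a l y))%E.
have E : (\int[leb]_y f (affine a l y) = X - Y)%E.
  by rewrite integralE -[X in X^\+%E]/(f \o affine a l) -[X in X^\-%E]/(f \o affine a l) funepos_comp funeneg_comp //.
have fX : X \is a fin_num.
  have XE : X = (l^-1%:E * (l%:E * X))%E.
    by rewrite muleA -EFinM mulVf ?mul1e// gt_eqF.
  rewrite XE fin_numM// /X -hp; apply: integrable_fin_num => //.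
  exact: integrable_funepos.
rewrite E muleBr ?fin_num_adde_defr// /X /Y -hp -hn; exact: integralE.
Qed.

(** Half-open on the left, where cells tile the line; closed on the right, where the one-variable
    estimates live. *)
Lemma Rintegral_affine (a l t : R) (h : R -> R) : 0 < l -> 0 <= t ->
  measurable_fun [set: measurableTypeR R] h -> (forall x, `|h x| <= 1) ->
  \int[leb]_(x in `[a, a + l * t[) h x = l * \int[leb]_(y in `[0, t]) h (a + l * y).
Proof.
move=> l0 t0 mh h1.
have ih (D : set (measurableTypeR R)) (k : R -> R) : measurable D -> (leb D < +oo)%E ->
    measurable_fun [set: measurableTypeR R] k -> (forall x, `|k x| <= 1) ->
    leb.-integrable D (EFin \o k).
  move=> mD lD mk k1; apply: measurable_bounded_integrable => //.
    exact: measurable_funTS.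
  exists 1; split => // M M1 x _; exact: le_trans (k1 x) (ltW M1).
rewrite Rintegral_itv_bndo_bndc; last first.
  apply: ih => //; rewrite lebesgue_measure_itv/=; by case: ifP => //; rewrite ltry.
pose D : set (measurableTypeR R) := `[a, a + l * t]%classic; pose D' : set (measurableTypeR R) := `[0, t]%classic.
pose f : measurableTypeR R -> \bar R := ((EFin \o h) \_ D)%E.
have intf : leb.-integrable setT f.
  have mD : measurable (D : set (measurableTypeR R)) by exact: measurable_itv.
  apply/(@integrable_mkcond _ _ _ _ D)=> //.
  by apply: ih => //; rewrite lebesgue_measure_itv/=; case: ifP => //; rewrite ltry.
rewrite /Rintegral integral_mkcond -/f (@integral_affine a l)//; last first.
  exact: (measurable_int leb).
rewrite [X in _ = _ * fine X]integral_mkcond.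
have E : (fun y => f (affine a l y)) = ((EFin \o (fun y => h (a + l * y)%R)) \_ D')%E.
  apply/funext => y; rewrite /f !patchE /affine/=.
  suff -> : (a + l * y \in `[a, a + l * t]%classic) = (y \in `[0, t]%classic) by [].
  rewrite !mem_setE !in_itv/= lerDl lerD2l ler_pM2l//.
  by rewrite pmulr_rge0.
have iD : leb.-integrable D' (EFin \o (fun y => h (a + l * y))).
  apply: ih => //; rewrite /D'.
  - exact: measurable_itv.
  - by rewrite lebesgue_measure_itv/=; case: ifP => //; rewrite ltry.
  - apply: (measurableT_comp mh); exact: measurable_affine.
rewrite E -!integral_mkcond fineM//.
exact: integrable_fin_num.
Qed.
End AffineChange.

(** * Integration against a density, and its shifts in L^1 *)

Section BVDensity.
Context {R : realType}.
Local Notation leb := (@lebesgue_measure R).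
Local Notation MR := (measurableTypeR R).
Variables (nu : probability MR R) (rho : MR -> R).
Hypothesis dens : has_density nu rho.

Lemma density_measurable : measurable_fun setT rho.
Proof. by have [/(measurable_int leb)/measurable_EFinP] := dens. Qed.

Lemma has_density_dominates : nu `<< leb.
Proof.
apply/null_content_dominatesP => A mA A0.
have [irho ->//] := dens.
apply: null_set_integral => //.
apply: measurable_funTS; apply/measurable_EFinP; exact: density_measurable.
Qed.

Lemma integral_has_density (h : MR -> R) : measurable_fun setT h ->
  (forall x, `|h x| <= 1) ->
  (\int[nu]_x (h x)%:E = \int[leb]_x (h x * rho x)%:E)%E.
Proof.
move=> mh h1.
have inth : nu.-integrable setT (EFin \o h).
  apply: measurable_bounded_integrable => //.
    by rewrite [X in (X < _)%E]probability_setT ltry.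
  by exists 1; split => // M M1 x _; exact: le_trans (h1 x) (ltW M1).
rewrite -[LHS](Radon_Nikodym_change_of_variables has_density_dominates measurableT inth).
have mrho := density_measurable.
apply: ae_eq_integral => //.
- apply: emeasurable_funM; first exact/measurable_EFinP.
  apply: (measurable_int leb); apply: Radon_Nikodym_integrable.
  exact: has_density_dominates.
- by apply/measurable_EFinP; exact: measurable_funM.
- under [X in ae_eq _ _ _ X]eq_fun do rewrite EFinM.
  apply: ae_eqe_mul2l => /=.
  apply: integral_ae_eq => //.
  + apply: Radon_Nikodym_integrable; exact: has_density_dominates.
  + exact/measurable_EFinP.
  + move=> E _ mE; rewrite -Radon_Nikodym_integral//.
      exact: (dens.2 E mE).
    exact: has_density_dominates.
Qed.

Lemma BV_shift (B h : R) : (BV_seminorm rho <= B%:E)%E -> 0 <= B ->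
  (\int[leb]_x `|rho (x + h) - rho x|%:E <= (B * `|h|)%:E)%E.
Proof.
move=> hB B0; have [->|h0] := eqVneq h 0.
  rewrite normr0 mulr0; under eq_integral do rewrite addr0 subrr normr0.
  by rewrite integral0.
have hp : 0 < `|h| by rewrite normr_gt0.
have : (`|h|^-1%:E * \int[leb]_x `|rho (x + h) - rho x|%:E <= B%:E)%E.
  apply: le_trans hB; rewrite /BV_seminorm.
  apply: (@le_trans _ _ (`|h|^-1%:E * ereal_sup
    [set \int[leb]_x `|rho (x + k) - rho x|%:E | k in [set k : R | (`|k| <= `|h|)%R]])%E).
    apply: lee_wpmul2l; first by rewrite lee_fin invr_ge0.
    by apply: ereal_sup_ubound; exists h => /=.
  by apply: ereal_sup_ubound; exists `|h| => /=.
rewrite lee_pdivrMl// => /le_trans; apply.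
by rewrite -EFinM mulrC.
Qed.

End BVDensity.

(** * Sums over grids and Abel summation *)

Section Grid.
Context {R : realType}.

(** Values lie in an arbitrary commutative monoid, to cover both real integrals and extended-real
    ones. *)
Lemma sum_grid (V : nmodType) (F : R -> R -> V) (a s : R) (N : nat) : 0 <= s ->
  (forall a c b, a <= c -> c <= b -> F a b = F a c + F c b) -> F a a = 0 ->
  \sum_(i < N) F (a + i%:R * s) (a + i.+1%:R * s) = F a (a + N%:R * s).
Proof.
move=> s0 Fadd F0; elim: N => [|N IH]; first by rewrite big_ord0 mul0r addr0 F0.
rewrite big_ord_recr/= IH [RHS](Fadd _ (a + N%:R * s))//.
  by rewrite lerDl mulr_ge0.
by rewrite lerD2l ler_wpM2r// ler_nat.
Qed.

Lemma itv_co_split (a c b : R) : a <= c -> c <= b ->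
  `[a, b[%classic = `[a, c[%classic `|` `[c, b[%classic.
Proof.
by move=> ac cb; rewrite -itv_bndbnd_setU.
Qed.

Lemma itv_co_disj (a c b : R) : [disjoint `[a, c[%classic & `[c, b[%classic].
Proof.
apply/disj_setPS => x [/=]; rewrite !in_itv/= => /andP[_ xc] /andP[cx _].
by move: xc; rewrite ltNge cx.
Qed.

Local Notation MR := (measurableTypeR R).

Lemma ge0_integral_co_split (mu : {measure set MR -> \bar R}) (g : MR -> \bar R) (a c b : R) :
  measurable_fun setT g -> (forall x, (0 <= g x)%E) -> a <= c -> c <= b ->
  (\int[mu]_(x in `[a, b[) g x =
   \int[mu]_(x in `[a, c[) g x + \int[mu]_(x in `[c, b[) g x)%E.
Proof.
move=> mg g0 ac cb; rewrite (itv_co_split ac cb) ge0_integral_setU//.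
- exact: measurable_funTS.
- exact: itv_co_disj.
Qed.

Lemma Rintegral_co_split (mu : {measure set MR -> \bar R}) (g : MR -> R) (a c b : R) :
  mu.-integrable setT (EFin \o g) -> a <= c -> c <= b ->
  \int[mu]_(x in `[a, b[) g x =
   \int[mu]_(x in `[a, c[) g x + \int[mu]_(x in `[c, b[) g x.
Proof.
move=> ig ac cb; rewrite (itv_co_split ac cb) Rintegral_setU//.
- by apply: integrableS ig => //; exact: measurableU.
- exact: itv_co_disj.
Qed.

Lemma sum_telescope_le (r : nat -> R) (k i : nat) : (i <= k)%N ->
  r k <= r i + \sum_(j < k) `|r j.+1 - r j|.
Proof.
elim: k => [|k IH] in i *; first by rewrite leqn0 => /eqP ->; rewrite big_ord0 addr0.
rewrite leq_eqVlt => /predU1P[->|ik].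
  by rewrite lerDl sumr_ge0.
rewrite big_ord_recr/= addrA; apply: le_trans (lerD (IH _ ik) (ler_norm _)).
by rewrite addrC subrK.
Qed.

Lemma abel_sum (r H : nat -> R) (k : nat) : H 0%N = 0 ->
  \sum_(i < k.+1) r i * (H i.+1 - H i) =
  r k * H k.+1 - \sum_(i < k) (r i.+1 - r i) * H i.+1.
Proof.
move=> H0; elim: k => [|k IH].
  by rewrite big_ord_recl !big_ord0 H0 !subr0 addr0.
rewrite big_ord_recr/= IH [in RHS]big_ord_recr/=; ring.
Qed.

End Grid.

(** * Approximation of a density by its cell averages *)

Section StepApproximation.
Context {R : realType}.
Local Notation leb := (@lebesgue_measure R).
Local Notation MR := (measurableTypeR R).
Variables (nu : probability MR R) (rho : MR -> R).
Hypothesis dens : has_density nu rho.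

Let mrho := density_measurable dens.

Lemma density_integrable : leb.-integrable setT (EFin \o rho).
Proof. by have [] := dens. Qed.

Lemma measurable_shift (u : R) : measurable_fun (setT : set MR) (fun x : MR => x + u : MR).
Proof. exact: measurable_funD. Qed.

Lemma shift_integrable (u : R) : leb.-integrable setT (EFin \o (fun x => rho (x + u))).
Proof.
apply/integrableP; split.
  by apply/measurable_EFinP; apply: (measurableT_comp mrho); exact: measurable_shift.
have /integrableP[_] := density_integrable.
rewrite (@ge0_integral_affine _ u 1 (fun x => `|(rho x)%:E|)%E)//; last first.
  by apply: measurableT_comp => //; exact/measurable_EFinP.
rewrite mul1e; congr (_ < _)%E; apply: eq_integral => x _.
by rewrite /affine mul1r addrC.
Qed.

Lemma prob_itvE (b s : R) : fine (nu `[b, b + s[%classic) = \int[leb]_(x in `[b, b + s[) rho x.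
Proof. by case: dens => _ -> //. Qed.

Definition modulus (dl : R) (x : MR) : \bar R :=
  (\int[leb]_(u in `[(- dl)%R, dl]) `|rho (x + u) - rho x|%:E)%E.

Lemma modulus_ge0 dl x : (0 <= modulus dl x)%E.
Proof. by apply: integral_ge0 => u _; rewrite lee_fin. Qed.

(** The deviation from the cell mean is dl^-1 times the integral of rho(x) - rho(y) over y in the
    cell, and y = x + u with |u| <= dl because x lies in the same cell. *)
Lemma step_error (b dl x : R) : 0 < dl -> b <= x < b + dl ->
  (`|rho x - fine (nu `[b, b + dl[%classic) / dl|%:E <= dl^-1%:E * modulus dl x)%E.
Proof.
move=> dl0 /andP[bx xb].
pose D : set MR := `[b, b + dl[%classic; rewrite -/D.
have mD : measurable D by exact: measurable_itv.
have lD : leb D = dl%:E.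
  by rewrite lebesgue_measure_itv/= lte_fin ltrDl dl0 -EFinB addrC addKr.
have icst (c : R) : leb.-integrable D (EFin \o cst c).
have lDoo : (leb D < +oo)%E by rewrite lD ltry.
  apply: measurable_bounded_integrable => //.
  exact: bounded_cst.
have iD : leb.-integrable D (EFin \o rho) by apply: integrableS density_integrable.
rewrite prob_itvE.
have -> : rho x - (\int[leb]_(y in D) rho y) / dl =
    dl^-1 * \int[leb]_(y in D) (rho x - rho y).
  have -> : \int[leb]_(y in D) (rho x - rho y) =
      \int[leb]_(y in D) (rho x) - \int[leb]_(y in D) rho y.
    by apply: RintegralB => //; exact: icst.
  have -> : \int[leb]_(y in D) (rho x) = rho x * dl.
    rewrite -[in RHS](_ : fine (leb D) = dl); last exact: (congr1 fine lD).
    exact: (@Rintegral_cst _ _ _ leb).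
  by field; rewrite gt_eqF.
rewrite normrM gtr0_norm ?invr_gt0// EFinM; apply: lee_wpmul2l.
  by rewrite lee_fin invr_ge0 ltW.
rewrite EFin_normr_Rintegral//; last exact: (integrableB mD (icst (rho x)) iD).
apply: le_trans (le_abse_integral _ _ _) _ => //.
  apply/measurable_EFinP; apply: measurable_funB => //; exact: measurable_funTS.
pose g (y : MR) : \bar R := `|rho x - rho y|%:E.
have mg : measurable_fun (setT : set MR) g.
  apply/measurable_EFinP; apply: (measurableT_comp (@normr_measurable _ setT)).
  exact: measurable_funB.
have mgD : measurable_fun (setT : set MR) (g \_ D)%E.
  by apply/(measurable_restrictT _ mD); exact: measurable_funTS.
have gD0 y : (0 <= (g \_ D) y)%E by rewrite patchE; case: ifP => _ //; rewrite lee_fin.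
rewrite [leLHS](_ : _ = \int[leb]_(y in D) g y)%E// integral_mkcond.
rewrite (@ge0_integral_affine _ x 1)// mul1e /modulus [leRHS]integral_mkcond.
apply: ge0_le_integral => //.
- apply: (measurableT_comp mgD); exact: measurable_affine.
- apply/(measurable_restrictT _ _).1 => //; apply: measurable_funTS.
  apply/measurable_EFinP; apply: (measurableT_comp (@normr_measurable _ setT)).
  apply: measurable_funB => //; apply: (measurableT_comp mrho).
  by apply: measurable_funD.
- move=> u _; rewrite !patchE /affine mul1r; case: ifPn => xuD; last by case: ifP => _ //; rewrite lee_fin.
  have -> : u \in `[(- dl)%R, dl]%classic.
    move: xuD; rewrite !inE /D/= !in_itv/= => /andP[h1 h2]; lra.
  by rewrite /g distrC.
Qed.

End StepApproximation.

Section CellError.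
Context {R : realType}.
Local Notation leb := (@lebesgue_measure R).
Local Notation MR := (measurableTypeR R).
Variables (nu : probability MR R) (rho : MR -> R).
Hypothesis dens : has_density nu rho.

Let mrho := density_measurable dens.
Let irho := density_integrable dens.

Lemma measurable_increment_pair :
  measurable_fun (setT : set (MR * MR)) (fun z : MR * MR => `|rho (z.1 + z.2) - rho z.1|).
Proof.
apply: (measurableT_comp (@normr_measurable _ setT)).
apply: measurable_funB; last exact: (measurableT_comp mrho).
apply: (@measurableT_comp _ _ _ _ _ _ rho setT (fun z : MR * MR => z.1 + z.2 : MR) mrho).
exact: measurable_funD.
Qed.

(** The indicator moves the range of the shift into the integrand, giving one jointly measurable
    function for Tonelli. *)
Definition increment_on (dl : R) (z : MR * MR) : \bar R :=
  (`|rho (z.1 + z.2) - rho z.1| * \1_(`[- dl, dl]%classic : set MR) z.2)%:E.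

Lemma measurable_increment_on dl : measurable_fun setT (increment_on dl).
Proof.
apply/measurable_EFinP; apply: measurable_funM; first exact: measurable_increment_pair.
by apply: (@measurableT_comp _ _ _ _ _ _ (\1_(`[- dl, dl]%classic : set MR) : MR -> R) setT snd).
Qed.

Lemma increment_on_ge0 dl z : (0 <= increment_on dl z)%E.
Proof. by rewrite lee_fin mulr_ge0. Qed.

Lemma modulusE dl x : modulus rho dl x = (\int[leb]_u increment_on dl (x, u))%E.
Proof.
rewrite /modulus integral_mkcond; apply: eq_integral => u _.
rewrite patchE /increment_on/= indicE; case: ifP => h; rewrite ?mulr1 ?mulr0//.
Qed.

Lemma measurable_modulus dl : measurable_fun setT (modulus rho dl).
Proof.
rewrite (_ : modulus rho dl = fubini_F leb (increment_on dl)); last first.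
  by apply/funext => x; rewrite modulusE.
apply: measurable_fun_fubini_tonelli_F; first exact: measurable_increment_on.
exact: increment_on_ge0.
Qed.

(** After exchanging the integrals, each shift u costs at most B |u| <= B dl, over a range of length
    2 dl. The square matters: the error is divided by dl and must still tend to 0. *)
Lemma integral_modulus_le (B dl : R) : (BV_seminorm rho <= B%:E)%E -> 0 <= B ->
  0 < dl -> (\int[leb]_x modulus rho dl x <= (2 * B * dl ^+ 2)%:E)%E.
Proof.
move=> hB B0 dl0.
under eq_integral do rewrite modulusE.
rewrite (@fubini_tonelli _ _ _ _ _ leb leb (increment_on dl)
  (measurable_increment_on dl) (increment_on_ge0 dl)).
apply: (@le_trans _ _ (\int[leb]_y (B * dl * \1_(`[- dl, dl]%classic : set MR) y)%:E)%E).
  apply: ge0_le_integral => //.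
  - by move=> y _; apply: integral_ge0 => x _; exact: increment_on_ge0.
  - apply: measurable_fun_fubini_tonelli_G; first exact: measurable_increment_on.
    exact: increment_on_ge0.
  - apply/measurable_EFinP; exact: measurable_funM.
  - move=> y _; rewrite /increment_on/= indicE.
    case: (boolP (y \in _)) => yD; last first.
      by under eq_integral do rewrite mulr0; rewrite integral0 mulr0.
    under eq_integral do rewrite mulr1.
    apply: le_trans (BV_shift y hB B0) _; rewrite lee_fin mulr1.
    apply: ler_wpM2l => //; move: yD; rewrite inE/= in_itv/= ler_norml.
    by [].
under eq_integral do rewrite EFinM.
rewrite ge0_integralZl//; last 2 first.
- exact/measurable_EFinP.
- by rewrite lee_fin mulr_ge0// ltW.
have E : leb `[- dl, dl] = (2 * dl)%:E.
  by rewrite lebesgue_measure_itv/= lte_fin ifT ?EFinB; [congr (_%:E); ring|lra].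
rewrite integral_indic// setIT; apply: (@le_trans _ _ ((B * dl)%:E * (2 * dl)%:E)%E).
  by rewrite -E.
by rewrite -EFinM lee_fin; lra.
Qed.

Variable h : MR -> R.
Hypothesis mh : measurable_fun setT h.
Hypothesis h1 : forall x, `|h x| <= 1.

Lemma bounded_mul_density_integrable : leb.-integrable setT (EFin \o (fun x => h x * rho x)).
Proof.
apply: le_integrable irho => //.
  by apply/measurable_EFinP; exact: measurable_funM.
by move=> x _ /=; rewrite lee_fin normrM ler_piMl.
Qed.

Lemma bounded_itv_integrable (u v : R) : leb.-integrable `[u, v[ (EFin \o h).
Proof.
have E : (leb `[u, v[ < +oo)%E.
  by rewrite lebesgue_measure_itv/=; case: ifP => // _; rewrite ltry.
apply: measurable_bounded_integrable => //.
- exact: measurable_funTS.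
- by exists 1; split => // M M1 x _; exact: le_trans (h1 x) (ltW M1).
Qed.

Lemma cell_error (b dl : R) : 0 < dl ->
  (`|(\int[leb]_(x in `[b, b + dl[) (h x * rho x) -
    fine (nu `[b, b + dl[%classic) / dl * \int[leb]_(x in `[b, b + dl[) h x)%R|%:E <=
   dl^-1%:E * \int[leb]_(x in `[b, (b + dl)%R[) modulus rho dl x)%E.
Proof.
move=> dl0; pose D : set MR := `[b, b + dl[%classic; rewrite -/D.
pose r := fine (nu D) / dl; rewrite -/r.
have mD : measurable D by exact: measurable_itv.
have ihD : leb.-integrable D (EFin \o h) by exact: bounded_itv_integrable.
have irhD : leb.-integrable D (EFin \o (fun x => h x * rho x)).
  by apply: integrableS bounded_mul_density_integrable.
have irh : leb.-integrable D (EFin \o (fun x => r * h x)) by exact: (integrableZl mD r ihD).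
have mrh : measurable_fun D (fun x => h x * rho x - r * h x).
  by apply: measurable_funB; apply: measurable_funM => //; exact: measurable_funTS.
rewrite -RintegralZl// -RintegralB// EFin_normr_Rintegral//; last exact: (integrableB mD irhD irh).
apply: le_trans (le_abse_integral _ _ _) _ => //; first exact/measurable_EFinP.
rewrite -ge0_integralZl//; first last.
- by rewrite lee_fin invr_ge0 ltW.
- by move=> x _; exact: modulus_ge0.
- by apply: measurable_funTS; exact: measurable_modulus.
apply: ge0_le_integral => //.
- apply/measurable_EFinP; exact: (measurableT_comp (@normr_measurable _ setT) mrh).
- apply: emeasurable_funM => //; by apply: measurable_funTS; exact: measurable_modulus.
- move=> x; rewrite /D/= in_itv/= => xD.
  apply: le_trans (step_error dens dl0 xD); rewrite lee_fin.
  rewrite (mulrC r) -mulrBr normrM ler_piMl//.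
Qed.

End CellError.

(** * One block of a density as a signed mixture of uniform laws *)

Section BlockDecomposition.
Context {R : realType}.
Local Notation leb := (@lebesgue_measure R).
Local Notation MR := (measurableTypeR R).
Variables (nu : probability MR R) (rho : MR -> R).
Hypothesis dens : has_density nu rho.

Let mrho := density_measurable dens.
Let irho := density_integrable dens.

Lemma increment_integrable (dl : R) (D : set MR) : measurable D ->
  leb.-integrable D (EFin \o (fun x => rho (x + dl) - rho x)).
Proof.
move=> mD; apply: (@integrableS _ _ _ leb setT) => //.
exact: (integrableB measurableT (shift_integrable dens dl) irho).
Qed.

Lemma cell_mass_increment (b dl : R) : 0 < dl ->
  `|fine (nu `[b + dl, b + dl + dl[%classic) - fine (nu `[b, b + dl[%classic)| <=
  \int[leb]_(x in `[b, b + dl[) `|rho (x + dl) - rho x|.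
Proof.
move=> dl0.
have mD : measurable (`[b, b + dl[%classic : set MR) by exact: measurable_itv.
have -> : fine (nu `[b + dl, b + dl + dl[%classic) =
    \int[leb]_(x in `[b, b + dl[) rho (x + dl).
  rewrite (prob_itvE dens); pose D' : set MR := `[b + dl, b + dl + dl[%classic.
  have mD' : measurable D' by exact: measurable_itv.
  pose f : MR -> \bar R := ((EFin \o rho) \_ D')%E.
  have iD' : leb.-integrable D' (EFin \o rho) by exact: integrableS irho.
  have intf : leb.-integrable setT f by apply/(@integrable_mkcond _ _ _ _ D').
  rewrite /Rintegral integral_mkcond -/f (@integral_affine _ dl 1)//; last first.
    exact: (measurable_int leb).
  rewrite mul1e; congr fine; rewrite [RHS]integral_mkcond; apply: eq_integral => x _.
  rewrite /f !patchE /affine mul1r /=.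
  have -> : (dl + x \in D') = (x \in `[b, b + dl[%classic).
    by rewrite /D' !mem_setE !in_itv/= !(addrC dl) lerD2r ltrD2r.
  by rewrite (addrC dl x).
rewrite (prob_itvE dens) -RintegralB//; last 2 first.
- by apply: integrableS (shift_integrable dens dl).
- by apply: integrableS irho.
by apply: le_normr_Rintegral => //; exact: increment_integrable.
Qed.

(** On the cells [rho] is replaced by its means r_i. Abel summation then leaves only integrals of h
    over initial segments of the block, all of which are images of intervals [0, tau] under the same
    affine map y -> a + l y. The list is found before [h], and the error remains an integral over
    the block, so that blocks can be added up. *)
Lemma block_decomposition (a l : R) (k : nat) (dl := l / k.+1%:R) : 0 < l ->
  exists s : seq (R * R), [/\ all (fun p => 0 <= p.2 <= 1) s,
    \sum_(p <- s) `|p.1| <= fine (nu `[a, a + l[%classic) +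
      2 * (l / dl) * \int[leb]_(x in `[a, a + l[) `|rho (x + dl) - rho x| &
    forall h : MR -> R, measurable_fun setT h -> (forall x, `|h x| <= 1) ->
      (`|(\int[leb]_(x in `[a, a + l[) (h x * rho x))%R|%:E <=
       dl^-1%:E * \int[leb]_(x in `[a, (a + l)%R[) modulus rho dl x +
       (\sum_(p <- s) `|p.1| * `|itv_int (fun y => h (a + l * y)) 0 p.2|)%:E)%E].
Proof.
move=> l0.
have dl0 : 0 < dl by rewrite divr_gt0.
have kl : k.+1%:R * dl = l by rewrite /dl mulrC divfK.
pose m i := fine (nu `[a + i%:R * dl, a + i%:R * dl + dl[%classic).
pose r i := m i / dl.
have m0 i : 0 <= m i by rewrite fine_ge0.
have stepE i : a + i.+1%:R * dl = a + i%:R * dl + dl.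
  by rewrite -addn1 natrD mulrDl mul1r addrA.
pose V := \int[leb]_(x in `[a, a + l[) `|rho (x + dl) - rho x|.
have V0 : 0 <= V by apply: Rintegral_ge0.
have iV (D : set MR) : measurable D ->
    leb.-integrable D (EFin \o (fun x => `|rho (x + dl) - rho x|)).
  by move=> mD; apply: integrable_norm; exact: increment_integrable.
have sumV : \sum_(i < k.+1)
    (\int[leb]_(x in `[a + i%:R * dl, a + i%:R * dl + dl[) `|rho (x + dl) - rho x|) = V.
  rewrite /V -kl -(@sum_grid _ _ (fun u v => \int[leb]_(x in `[u, v[) `|rho (x + dl) - rho x|)).
  - by apply: eq_bigr => i _; rewrite stepE.
  - exact: ltW.
  - by move=> u w v uw wv; apply: Rintegral_co_split => //; exact: iV.
  - by rewrite set_itvco0 Rintegral_set0.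
(* Only [k] of the [k.+1] cells are compared with their successor; the last integral, which looks
   into the next block, is nonnegative and is dropped. *)
have var_r : \sum_(i < k) `|r i.+1 - r i| <= V / dl.
  rewrite ler_pdivlMr// -sumV big_ord_recr/= mulr_suml.
  apply: (@le_trans _ _ (\sum_(i < k) \int[leb]_(x in `[a + i%:R * dl, a + i%:R * dl + dl[)
      `|rho (x + dl) - rho x|)); last first.
    by rewrite lerDl; apply: Rintegral_ge0.
  apply: ler_sum => i _; rewrite /r -mulrBl normrM normfV (gtr0_norm dl0) divfK ?gt_eqF//.
  by rewrite /m stepE; exact: cell_mass_increment.
have sum_m : \sum_(i < k.+1) m i = fine (nu `[a, a + l[%classic).
  rewrite (prob_itvE dens) -kl -(@sum_grid _ _ (fun u v => \int[leb]_(x in `[u, v[) rho x)).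
  - by apply: eq_bigr => i _; rewrite /m stepE (prob_itvE dens).
  - exact: ltW.
  - by move=> u w v uw wv; apply: Rintegral_co_split.
  - by rewrite set_itvco0 Rintegral_set0.
(* The last height is at most the mean height plus the total variation, and l times the mean height
   is the mass of the block. *)
have rk : l * r k <= fine (nu `[a, a + l[%classic) + l * (V / dl).
  have : k.+1%:R * r k <= \sum_(i < k.+1) (r i + V / dl).
    rewrite mulr_natl -[X in _ *+ X]card_ord -sumr_const; apply: ler_sum => i _.
    apply: le_trans (sum_telescope_le r (ltnSE (ltn_ord i))) _.
    by rewrite lerD2l.
  rewrite big_split/= sumr_const card_ord -mulr_suml sum_m => H.
  have -> : l * r k = dl * (k.+1%:R * r k) by rewrite -{1}kl; ring.
  have -> : l * (V / dl) = k.+1%:R * V by rewrite -{1}kl; field; rewrite gt_eqF.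
  move: H; rewrite -[_ *+ k.+1]mulr_natr => H.
  apply: le_trans (ler_wpM2l (ltW dl0) H) _.
  by rewrite le_eqVlt; apply/orP; left; apply/eqP; field; rewrite gt_eqF.
(* Each entry is a signed weight and a length tau; the factor [l] in the weights is the Jacobian of
   the affine map. *)
exists ((l * r k, 1) :: [seq (- (l * (r i.+1 - r i)), i.+1%:R / k.+1%:R) | i <- index_iota 0 k]).
split.
- rewrite /= lexx ler01/=; apply/allP => _ /mapP[i + ->] /=; rewrite mem_index_iota/=.
  move=> ik; rewrite divr_ge0//= ler_pdivrMr// mul1r ler_nat.
  exact: ltnW.
- rewrite big_cons big_map/=.
  rewrite (big_mkord xpredT (fun i => `|- (l * (r i.+1 - r i))|)).
  rewrite ger0_norm; last by rewrite mulr_ge0 ?divr_ge0 // ltW.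
  under eq_bigr do rewrite normrN normrM (gtr0_norm l0).
  rewrite -mulr_sumr -/V.
  have := ler_wpM2l (ltW l0) var_r.
  have -> : 2 * (l / dl) * V = l * (V / dl) + l * (V / dl) by ring.
  by move: rk; lra.
move=> h mh h1.
pose H i := \int[leb]_(x in `[a, a + i%:R * dl[) h x.
have HE i : H i = l * itv_int (fun y => h (a + l * y)) 0 (i%:R / k.+1%:R).
  rewrite /H /itv_int -Rintegral_affine// ?divr_ge0//.
  by rewrite (_ : i%:R * dl = l * (i%:R / k.+1%:R))// /dl; ring.
have H0 : H 0%N = 0 by rewrite /H mul0r addr0 set_itvco0 Rintegral_set0.
have ihr := bounded_mul_density_integrable dens mh h1.
have Hcell i : \int[leb]_(x in `[a + i%:R * dl, a + i%:R * dl + dl[) h x = H i.+1 - H i.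
  have ai : a <= a + i%:R * dl by rewrite lerDl mulr_ge0 ?(ltW dl0).
  have aii : a + i%:R * dl <= a + i%:R * dl + dl by rewrite lerDl ltW.
  have ih2 := bounded_itv_integrable mh h1 a (a + i%:R * dl + dl).
  apply/eqP; rewrite eq_sym subr_eq addrC; apply/eqP.
  rewrite /H stepE [in LHS](itv_co_split ai aii) Rintegral_setU//.
  - by rewrite -(itv_co_split ai aii).
  - exact: itv_co_disj.
have hrE : \int[leb]_(x in `[a, a + l[) (h x * rho x) =
    \sum_(i < k.+1) \int[leb]_(x in `[a + i%:R * dl, a + i%:R * dl + dl[) (h x * rho x).
  rewrite -kl -(@sum_grid _ _ (fun u v => \int[leb]_(x in `[u, v[) (h x * rho x))).
  - by apply: eq_bigr => i _; rewrite stepE.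
  - exact: ltW.
  - by move=> u w v uw wv; apply: Rintegral_co_split.
  - by rewrite set_itvco0 Rintegral_set0.
pose S := \sum_(i < k.+1) r i * (H i.+1 - H i).
have errS : (`|\int[leb]_(x in `[a, a + l[) (h x * rho x) - S|%R%:E <=
    dl^-1%:E * \int[leb]_(x in `[a, (a + l)%R[) modulus rho dl x)%E.
  rewrite hrE -sumrB.
  apply: (@le_trans _ _ (\sum_(i < k.+1) (dl^-1%:E *
      \int[leb]_(x in `[(a + i%:R * dl)%R, (a + i%:R * dl + dl)%R[) modulus rho dl x))%E).
    apply: (@le_trans _ _ (\sum_(i < k.+1)
        `|\int[leb]_(x in `[a + i%:R * dl, a + i%:R * dl + dl[) (h x * rho x) -
          r i * (H i.+1 - H i)|%:E)%E).
      by rewrite sumEFin lee_fin; exact: ler_norm_sum.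
    apply: lee_sum => i _; rewrite -Hcell; exact: cell_error.
  rewrite -ge0_sume_distrr; last first.
    by move=> i _; apply: integral_ge0 => x _; exact: modulus_ge0.
  apply: lee_wpmul2l; first by rewrite lee_fin invr_ge0 ltW.
  rewrite -kl -(@sum_grid _ _ (fun u v => \int[leb]_(x in `[u, v[) modulus rho dl x)%E).
  - by apply: lee_sum => i _; rewrite stepE.
  - exact: ltW.
  - move=> u w v uw wv; apply: ge0_integral_co_split => //.
      exact: (measurable_modulus dens).
    by move=> x; exact: modulus_ge0.
  - by rewrite set_itvco0 integral_set0.
have Sle : `|S| <= \sum_(p <- (l * r k, 1) ::
    [seq (- (l * (r i.+1 - r i)), i.+1%:R / k.+1%:R) | i <- index_iota 0 k])
    `|p.1| * `|itv_int (fun y => h (a + l * y)) 0 p.2|.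
  rewrite big_cons big_map/=.
  rewrite (big_mkord xpredT (fun i => `|- (l * (r i.+1 - r i))| *
    `|itv_int (fun y => h (a + l * y)) 0 (i.+1%:R / k.+1%:R)|)).
  rewrite /S abel_sum//; apply: le_trans (ler_normB _ _) _; apply: lerD.
    by rewrite -normrM HE divff ?pnatr_eq0// mulrCA mulrA.
  apply: le_trans (ler_norm_sum _ _ _) _; apply: ler_sum => i _.
  by rewrite -normrM HE mulrCA mulrA mulNr normrN.
apply: (@le_trans _ _ (`|\int[leb]_(x in `[a, a + l[) (h x * rho x) - S|%R%:E + `|S|%R%:E)%E).
  rewrite -EFinD lee_fin; have := ler_normD (\int[leb]_(x in `[a, a + l[) (h x * rho x) - S) S.
  by rewrite subrK.
by apply: leeD => //; rewrite lee_fin.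
Qed.

End BlockDecomposition.

(** * A whole density as a signed mixture *)

Section Mixture.
Context {R : realType}.
Local Notation leb := (@lebesgue_measure R).
Local Notation MR := (measurableTypeR R).
Variables (nu : probability MR R) (rho : MR -> R).
Hypothesis dens : has_density nu rho.

Let mrho := density_measurable dens.
Let irho := density_integrable dens.

Lemma prob_tail_small (l eta : R) : 0 < l -> 0 < eta ->
  exists N : nat, 1 - eta <= fine (nu `[- (N%:R * l), N%:R * l[%classic).
Proof.
move=> l0 eta0.
pose D n : set MR := `[- (n%:R * l), n%:R * l[%classic.
have cD : nu (D n) @[n --> \oo] --> nu (\bigcup_n D n).
  apply: nondecreasing_cvg_mu.
  - by move=> n; exact: measurable_itv.
  - by apply: bigcup_measurable => n _; exact: measurable_itv.
  - move=> n1 n2 n12; apply/subsetPset; apply: subset_itv; rewrite bnd_simp.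
      by rewrite lerN2 ler_wpM2r ?ler_nat// ltW.
    by rewrite ler_wpM2r ?ler_nat// ltW.
have DT : \bigcup_n D n = setT.
  apply/seteqP; split => // x _.
  exists (Num.bound (`|x| / l)) => //; rewrite /D/= in_itv/=.
  have : `|x| / l < (Num.bound (`|x| / l))%:R by apply: archi_boundP; rewrite divr_ge0// ltW.
  rewrite ltr_pdivrMr// ltr_norml => /andP[h1 h2].
  by rewrite ltW.
rewrite DT probability_setT in cD.
have /fine_cvgP[_ c1] := cD.
have : 1 - eta < 1 by lra.
move=> /(cvgr_gt _ c1) [N _ /(_ N (leqnn N)) h]; exists N.
exact: ltW.
Qed.

(** The weights add up to at most the total mass 1 plus 2 l B <= 2, which is what fixes the block
    length l. The list is the same for all [h]; this is essential, since [h] will depend on the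
    remaining variables. A far tail of mass eta/2 is discarded to keep the list finite. *)
Lemma mixture_bound (B eta : R) (l := (1 + B)^-1) : 0 <= B -> 0 < eta ->
  (BV_seminorm rho <= B%:E)%E ->
  exists s : seq (R * R * R), [/\ all (fun p => 0 <= p.2 <= 1) s,
    \sum_(p <- s) `|p.1.1| <= 3 &
    forall h : MR -> R, measurable_fun setT h -> (forall x, `|h x| <= 1) ->
      `|\int[nu]_x h x| <=
       eta + \sum_(p <- s) `|p.1.1| * `|itv_int (fun y => h (p.1.2 + l * y)) 0 p.2|].
Proof.
move=> B0 eta0 hB.
have l0 : 0 < l by rewrite invr_gt0; lra.
have lB : l * B <= 1 by rewrite mulrC ler_pdivrMr; lra.
have [N hN] := prob_tail_small l0 (divr_gt0 eta0 (ltr0n R 2)).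
pose A := - (N%:R * l).
pose D : set MR := `[A, A + (N + N)%:R * l[%classic.
have DE : D = `[- (N%:R * l), N%:R * l[%classic.
  by rewrite /D (_ : A + (N + N)%:R * l = N%:R * l)// /A natrD; ring.
have mD : measurable D by exact: measurable_itv.
(* So fine a grid that the total cell error dl^-1 * 2 B dl^2 is at most eta/2. *)
pose k := Num.bound (4 * B * l / eta).
pose dl := l / k.+1%:R.
have dl0 : 0 < dl by rewrite divr_gt0.
have dlB : 2 * B * dl <= eta / 2.
  have : 4 * B * l / eta < k%:R by apply: archi_boundP; rewrite divr_ge0 ?mulr_ge0// ltW.
  rewrite ltr_pdivrMr// => h; rewrite /dl mulrA ler_pdivrMr//.
  rewrite -[k.+1%:R]natr1 mulrDr mulr1; lra.
have [S HS] := @choice _ _ _ (fun i : nat => block_decomposition dens (A + i%:R * l) k l0).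
rewrite -/dl in HS.
have stepE i : A + i.+1%:R * l = A + i%:R * l + l.
  by rewrite -addn1 natrD mulrDl mul1r addrA.
pose V (E : set MR) := \int[leb]_(x in E) `|rho (x + dl) - rho x|.
have iV (E : set MR) : measurable E ->
    leb.-integrable E (EFin \o (fun x => `|rho (x + dl) - rho x|)).
  by move=> mE; apply: integrable_norm; exact: (increment_integrable dens dl mE).
have VD : V D <= B * dl.
  rewrite -lee_fin /V /Rintegral fineK; last first.
    by apply: integrable_fin_num => //; exact: iV.
  have := BV_shift dl hB B0; rewrite gtr0_norm// => /(le_trans _); apply.
  apply: ge0_subset_integral => //; apply/measurable_EFinP.
  apply: (measurableT_comp (@normr_measurable _ setT)).
  apply: measurable_funB => //; apply: (measurableT_comp mrho).
  exact: measurable_shift.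
exists (flatten [seq [seq (p.1, A + i%:R * l, p.2) | p <- S i] | i <- index_iota 0 (N + N)]).
split.
- apply/allP => _ /flatten_mapP[i _ /mapP[p pS ->]] /=.
  by have [/allP/(_ p pS)] := HS i.
- rewrite big_flatten big_map.
  apply: (@le_trans _ _ (\sum_(0 <= i < N + N) (fine (nu `[A + i%:R * l, A + i%:R * l + l[%classic) +
      2 * (l / dl) * V `[A + i%:R * l, A + i%:R * l + l[%classic))).
    by apply: ler_sum => i _; rewrite big_map/=; have [] := HS i.
  rewrite big_mkord big_split/= -mulr_sumr.
  have -> : \sum_(i < N + N) fine (nu `[A + i%:R * l, A + i%:R * l + l[%classic) = fine (nu D).
    rewrite (prob_itvE dens) -(@sum_grid _ _ (fun u v => \int[leb]_(x in `[u, v[) rho x)).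
    + by apply: eq_bigr => i _; rewrite stepE (prob_itvE dens).
    + exact: ltW.
    + by move=> u w v uw wv; apply: Rintegral_co_split.
    + by rewrite set_itvco0 Rintegral_set0.
  have -> : \sum_(i < N + N) V `[A + i%:R * l, A + i%:R * l + l[%classic = V D.
    rewrite -(@sum_grid _ _ (fun u v => V `[u, v[%classic)).
    + by apply: eq_bigr => i _; rewrite stepE.
    + exact: ltW.
    + by move=> u w v uw wv; apply: Rintegral_co_split => //; exact: iV.
    + by rewrite /V set_itvco0 Rintegral_set0.
  have n1 : fine (nu D) <= 1.
    by rewrite -lee_fin fineK ?probability_le1// fin_num_measure.
  have : 2 * (l / dl) * V D <= 2 * (l / dl) * (B * dl).
    by apply: ler_wpM2l => //; rewrite mulr_ge0// divr_ge0// ltW.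
  have -> : 2 * (l / dl) * (B * dl) = 2 * (l * B) by field; rewrite gt_eqF.
  lra.
move=> h mh h1.
rewrite big_flatten big_map.
under eq_bigr do rewrite big_map/=.
set W := (X in eta + X).
have ihr := bounded_mul_density_integrable dens mh h1.
have m1D : measurable_fun setT (\1_D : MR -> R) by exact: measurable_indic.
have m1C : measurable_fun setT (\1_(~` D) : MR -> R) by apply: measurable_indic; exact: measurableC.
have ind01 (E : set MR) x : 0 <= (\1_E x : R) <= 1.
  by rewrite indicE; case: (_ \in _); rewrite lexx ler01.
have hD : `|\int[leb]_(x in D) (h x * rho x)| <= eta / 2 + W.
  rewrite -lee_fin; pose Bk i : set MR := `[A + i%:R * l, A + i%:R * l + l[%classic.
  have hDE : \int[leb]_(x in D) (h x * rho x) =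
      \sum_(i < N + N) \int[leb]_(x in Bk i) (h x * rho x).
    rewrite -(@sum_grid _ _ (fun u v => \int[leb]_(x in `[u, v[) (h x * rho x))).
    + by apply: eq_bigr => i _; rewrite stepE.
    + exact: ltW.
    + by move=> u w v uw wv; apply: Rintegral_co_split.
    + by rewrite set_itvco0 Rintegral_set0.
  pose wt i := \sum_(p <- S i) `|p.1| * `|itv_int (fun y => h (A + i%:R * l + l * y)) 0 p.2|.
  apply: (@le_trans _ _ (\sum_(i < N + N) (dl^-1%:E * \int[leb]_(x in Bk i) modulus rho dl x +
      (wt i)%:E))%E).
    apply: (@le_trans _ _ (\sum_(i < N + N) `|\int[leb]_(x in Bk i) (h x * rho x)|%R%:E)%E).
      by rewrite hDE sumEFin lee_fin; exact: ler_norm_sum.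
    by apply: lee_sum => i _; have [_ _ /(_ h mh h1)] := HS i.
  rewrite big_split/= sumEFin EFinD; apply: leeD; last first.
    by rewrite lee_fin /W big_mkord.
  rewrite -ge0_sume_distrr; last first.
    by move=> i _; apply: integral_ge0 => x _; exact: modulus_ge0.
  have -> : (\sum_(i < N + N) \int[leb]_(x in Bk i) modulus rho dl x =
      \int[leb]_(x in D) modulus rho dl x)%E.
    rewrite -(@sum_grid _ _ (fun u v => \int[leb]_(x in `[u, v[) modulus rho dl x)%E).
    + by apply: eq_bigr => i _; rewrite stepE.
    + exact: ltW.
    + move=> u w v uw wv; apply: ge0_integral_co_split => //.
        exact: (measurable_modulus dens).
      by move=> x; exact: modulus_ge0.
    + by rewrite set_itvco0 integral_set0.
  apply: (@le_trans _ _ (dl^-1%:E * (2 * B * dl ^+ 2)%:E)%E).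
    apply: lee_wpmul2l; first by rewrite lee_fin invr_ge0 ltW.
    apply: le_trans (integral_modulus_le dens hB B0 dl0).
    apply: ge0_subset_integral => //.
      exact: (measurable_modulus dens).
    by move=> x _; exact: modulus_ge0.
  rewrite -EFinM lee_fin; apply: le_trans dlB.
  by rewrite le_eqVlt; apply/orP; left; apply/eqP; field; rewrite gt_eqF.
have inu (g : MR -> R) : measurable_fun setT g -> (forall x, `|g x| <= 1) ->
    nu.-integrable setT (EFin \o g).
  move=> mg g1; apply: measurable_bounded_integrable => //.
    by rewrite [X in (X < _)%E]probability_setT ltry.
  by exists 1; split => // M M1 x _; exact: le_trans (g1 x) (ltW M1).
have mprod (E : set MR) : measurable E -> measurable_fun setT (fun x : MR => h x * \1_E x).
  by move=> mE; apply: measurable_funM => //; exact: measurable_indic.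
have bprod (E : set MR) x : `|h x * \1_E x| <= 1.
  have /andP[i0 i1] := ind01 E x.
  by rewrite normrM (ger0_norm i0) mulr_ile1.
have -> : \int[nu]_x h x = \int[nu]_x (h x * \1_D x) + \int[nu]_x (h x * \1_(~` D) x).
  rewrite -RintegralD//; last 2 first.
  - by apply: inu => //; exact: mprod.
  - by apply: inu => //; apply: mprod; exact: measurableC.
  apply: eq_Rintegral => x _; rewrite -mulrDr !indicE in_setC.
  by case: (x \in D); rewrite ?addr0 ?add0r mulr1.
apply: le_trans (ler_normD _ _) _.
have E1 : \int[nu]_x (h x * \1_D x) = \int[leb]_(x in D) (h x * rho x).
  rewrite /Rintegral (integral_has_density dens (mprod _ mD) (bprod D)).
  rewrite [in RHS]integral_mkcond; congr fine; apply: eq_integral => x _.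
  by rewrite patchE indicE; case: (x \in D); rewrite ?mulr1 ?mulr0 ?mul0r.
have E2 : `|\int[nu]_x (h x * \1_(~` D) x)| <= eta / 2.
  apply: le_trans (le_normr_Rintegral _ _) _ => //.
    by apply: inu => //; apply: mprod; exact: measurableC.
  apply: (@le_trans _ _ (\int[nu]_x (\1_(~` D) x))).
    apply: le_Rintegral => //.
    - apply: (inu (fun x => `|h x * \1_(~` D) x|)).
        apply: (measurableT_comp (@normr_measurable _ setT)).
        by apply: mprod; exact: measurableC.
      by move=> x; rewrite normr_id.
    - by apply: inu => // x; have /andP[i0 i1] := ind01 (~` D) x; rewrite ger0_norm.
    - move=> x _; have /andP[i0 i1] := ind01 (~` D) x.
      by rewrite normrM (ger0_norm i0) ler_piMl.
  have mC : measurable (~` D) by exact: measurableC.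
  rewrite /Rintegral integral_indic//.
  rewrite setIT [X in fine X](_ : _ = (1 - nu D)%E); last exact: probability_setC.
  rewrite fineB ?fin_num_measure//= DE.
  move: hN; lra.
by rewrite E1; apply: le_trans (lerD hD E2) _; rewrite addrAC -splitr.
Qed.

End Mixture.

(** * Sparse multivariate polynomials *)

Section SparsePolynomials.
Variable R : realFieldType.
Implicit Types (s : seq (R * seq nat)) (j e : seq nat) (n d m : nat).

Definition monom_val n (e : seq nat) (x : n.-tuple R) : R :=
  \prod_(i < n) tnth x i ^+ nth 0%N e i.

(** Exponents may repeat in the list: removing the first variable can make distinct exponents equal,
    and no normal form has to be restored. *)
Definition sparse_val n s (x : n.-tuple R) : R :=
  \sum_(t <- s) t.1 * monom_val t.2 x.

Definition sparse_coef s j : R := \sum_(t <- s | t.2 == j) t.1.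

Definition sparse_wf n d m s :=
  all (fun t => [&& size t.2 == n, (sumn t.2 <= d)%N & all (geq m) t.2]) s.

Definition fix_first (a : R) s : seq (R * seq nat) :=
  [seq (t.1 * a ^+ head 0%N t.2, behead t.2) | t <- s].

(* The coefficient of [y ^ j0] in [s] at [(a + l * y, x')], as a polynomial in [x']. *)
Definition first_coef (a l : R) (j0 : nat) s : seq (R * seq nat) :=
  [seq (t.1 * (a ^+ (head 0%N t.2 - j0) * l ^+ j0 *+ 'C(head 0%N t.2, j0)), behead t.2)
     | t <- s & (j0 <= head 0%N t.2)%N].

Definition first_poly n s (a l : R) (x : n.-tuple R) : {poly R} :=
  \sum_(t <- s) (t.1 * monom_val (behead t.2) x) *: (a%:P + l *: 'X) ^+ head 0%N t.2.

Lemma monom_val_cons n e (a : R) (x : n.-tuple R) :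
  monom_val e [tuple of a :: x] = a ^+ head 0%N e * monom_val (behead e) x.
Proof.
rewrite /monom_val big_ord_recl tnth0 nth0; congr (_ * _).
by apply: eq_bigr => i _; rewrite tnthS -nth_behead.
Qed.

Lemma fix_first_val n s (a : R) (x : n.-tuple R) :
  sparse_val s [tuple of a :: x] = sparse_val (fix_first a s) x.
Proof.
rewrite /sparse_val big_map; apply: eq_bigr => t _.
by rewrite monom_val_cons mulrA.
Qed.

Lemma first_poly_val n s (a l y : R) (x : n.-tuple R) :
  (first_poly s a l x).[y] = sparse_val s [tuple of (a + l * y) :: x].
Proof.
rewrite /first_poly horner_sum; apply: eq_bigr => t _.
by rewrite !hornerE monom_val_cons [RHS]mulrCA mulrC.
Qed.

Lemma coef_affine_exp (a l : R) (k i : nat) :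
  ((a%:P + l *: 'X) ^+ k)`_i = if (i <= k)%N then a ^+ (k - i) * l ^+ i *+ 'C(k, i) else 0.
Proof.
rewrite exprDn coef_sum.
rewrite (eq_bigr (fun u : 'I_k.+1 => if (u == i :> nat) then a ^+ (k - i) * l ^+ i *+ 'C(k, i) else 0)).
  case: leqP => ik.
    rewrite (bigD1 (inord i))//= inordK ?ltnS// eqxx big1 ?addr0// => u ui.
    rewrite ifF//; apply: contraNF ui => /eqP ui; apply/eqP/val_inj.
    by rewrite /= inordK ?ltnS.
  by rewrite big1// => u _; rewrite ifF//; apply/negbTE; rewrite neq_ltn (leq_ltn_trans _ ik)// -ltnS.
move=> u _; rewrite coefMn exprZn -polyC_exp coefCM coefZ coefXn.
rewrite eq_sym; case: eqP => [->|_]; first by rewrite mulr1.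
by rewrite mulr0 mulr0 mul0rn.
Qed.

Lemma first_poly_coef n s (a l : R) (j0 : nat) (x : n.-tuple R) :
  (first_poly s a l x)`_j0 = sparse_val (first_coef a l j0 s) x.
Proof.
rewrite /first_poly coef_sum /sparse_val /first_coef big_map big_filter.
rewrite [RHS]big_mkcond; apply: eq_bigr => t _ /=.
rewrite coefZ coef_affine_exp; case: ifP => _; last by rewrite mulr0.
ring.
Qed.

Lemma size_first_poly n d m s (a l : R) (x : n.-tuple R) :
  sparse_wf n.+1 d m s -> (size (first_poly s a l x) <= (minn d m).+1)%N.
Proof.
move=> /allP wf; apply/leq_sizeP => k hk.
rewrite /first_poly coef_sum big_seq big1// => t /wf /and3P[/eqP st dt mt].
rewrite coefZ coef_affine_exp ifF ?mulr0//; apply/negbTE; rewrite -ltnNge.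
apply: leq_trans hk; rewrite ltnS leq_min.
case: t.2 st dt mt => //= e0 e _ ed /andP[-> _]; rewrite andbT.
exact: leq_trans (leq_addr _ _) ed.
Qed.

Lemma fix_first_wf n d m s (a : R) : sparse_wf n.+1 d m s -> sparse_wf n d m (fix_first a s).
Proof.
move=> /allP wf; apply/allP => _ /mapP[t /wf + ->] /=.
case: t.2 => //= e0 e /and3P[/eqP [->] ed /andP[_ ->]]; rewrite eqxx andbT/=.
exact: leq_trans (leq_addl _ _) ed.
Qed.

Lemma first_coef_wf n d m s (a l : R) (j0 : nat) : sparse_wf n.+1 d m s ->
  sparse_wf n (d - j0) m (first_coef a l j0 s).
Proof.
move=> /allP wf; apply/allP => _ /mapP[t + ->] /=.
rewrite mem_filter => /andP[je /wf].
case: t.2 je => //= e0 e je /and3P[/eqP [->] ed /andP[_ ->]]; rewrite eqxx andbT/=.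
rewrite leq_subRL; last exact: leq_trans je (leq_trans (leq_addr _ _) ed).
by apply: leq_trans ed; rewrite leq_add2r.
Qed.

Lemma fix_first_coef n d m s (a : R) j : sparse_wf n.+1 d m s -> sumn j = d ->
  sparse_coef (fix_first a s) j = sparse_coef s (0%N :: j).
Proof.
move=> /allP wf jd; rewrite /sparse_coef big_map /= big_seq_cond [RHS]big_seq_cond.
have E (t : R * seq nat) : t \in s -> (behead t.2 == j) = (t.2 == 0%N :: j).
  move=> /wf; case: t.2 => //= e0 e /and3P[_ ed _]; rewrite eqseq_cons.
  case: (eqVneq e j) ed => [->|]; rewrite ?andbF// andbT jd.
  by rewrite -{2}[d]add0n leq_add2r leqn0.
rewrite (eq_bigl (fun t => (t \in s) && (t.2 == 0%N :: j))) => [|t].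
  by apply: eq_bigr => t /andP[_ /eqP ->]; rewrite /= expr0 mulr1.
by case: (boolP (t \in s)) => // /E ->.
Qed.

(** A higher power of the first variable would force the remaining degree below that of [j]. Hence
    only terms with first exponent exactly j0 contribute, and the translation [a] drops out. *)
Lemma first_coef_coef n d m s (a l : R) (j0 : nat) j : sparse_wf n.+1 d m s ->
  (j0 + sumn j)%N = d ->
  sparse_coef (first_coef a l j0 s) j = l ^+ j0 * sparse_coef s (j0 :: j).
Proof.
move=> /allP wf jd; rewrite /sparse_coef big_map big_filter_cond /=.
rewrite big_distrr/= big_seq_cond [RHS]big_seq_cond.
have E (t : R * seq nat) : t \in s ->
    (j0 <= head 0%N t.2)%N && (behead t.2 == j) = (t.2 == j0 :: j).
  move=> /wf; case: t.2 => [//|e0 e] /= /and3P[_ ed _]; rewrite eqseq_cons.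
  case: (eqVneq e j) ed => [->|]; rewrite ?andbF// !andbT -jd leq_add2r => h.
  by rewrite eq_sym eqn_leq h andbT.
rewrite (eq_bigl (fun t => (t \in s) && (t.2 == j0 :: j))) => [|t].
  apply: eq_bigr => t /andP[_ /eqP ->] /=.
  by rewrite subnn expr0 mul1r binn mulr1n mulrC.
by case: (boolP (t \in s)) => // /E ->.
Qed.

End SparsePolynomials.

(** * Iterated integration *)

Section BoundedIntegrals.
Context d (T : measurableType d) (R : realType).
Variable mu : probability T R.

Definition bounded_by (c : R) (f : T -> R) := forall x, `|f x| <= c.

Lemma prob_bounded_integrable (c : R) (f : T -> R) :
  measurable_fun setT f -> bounded_by c f -> mu.-integrable setT (EFin \o f).
Proof.
move=> mf fc; apply: measurable_bounded_integrable => //.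
  by rewrite [X in (X < _)%E]probability_setT ltry.
by exists c; split => [|M M1 x _]; rewrite ?num_real//; exact: le_trans (fc x) (ltW M1).
Qed.

Lemma prob_Rintegral_cst (c : R) : \int[mu]_x c = c.
Proof.
have E : fine (mu setT) = 1 by rewrite probability_setT.
by rewrite (@Rintegral_cst _ _ _ mu)// -[RHS]mulr1 -E.
Qed.

Lemma prob_Rintegral_le (c : R) (f : T -> R) : measurable_fun setT f ->
  bounded_by c f -> `|\int[mu]_x f x| <= c.
Proof.
move=> mf fc; have intf := prob_bounded_integrable mf fc.
apply: le_trans (le_normr_Rintegral _ intf) _ => //.
rewrite -[leRHS]prob_Rintegral_cst; apply: le_Rintegral => //.
- exact: integrable_norm intf.
- apply: (@prob_bounded_integrable `|c|) => // x; exact: lexx.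
Qed.

Lemma prob_Rintegral_sum (I : Type) (s : seq I) (e c : R) (w : I -> R) (f : I -> T -> R) :
  (forall i, measurable_fun setT (f i)) -> (forall i, bounded_by c (f i)) ->
  \int[mu]_x (e + \sum_(i <- s) w i * f i x) = e + \sum_(i <- s) w i * \int[mu]_x f i x.
Proof.
move=> mf fc; elim: s => [|i s IH].
  by rewrite big_nil addr0; under eq_Rintegral do rewrite big_nil addr0; exact: prob_Rintegral_cst.
have ii j : mu.-integrable setT (EFin \o f j) by exact: prob_bounded_integrable (fc j).
have iw j : mu.-integrable setT (EFin \o (fun x => w j * f j x)).
  exact: (integrableZl measurableT (w j) (ii j)).
have is' : mu.-integrable setT (EFin \o (fun x => e + \sum_(j <- s) w j * f j x)).
  elim: s {IH} => [|j s IH].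
    under eq_fun do rewrite big_nil addr0.
    by apply: (@prob_bounded_integrable `|e|) => // x; exact: lexx.
  rewrite (_ : _ \o _ = ((EFin \o (fun x => w j * f j x)%R) \+
      (EFin \o (fun x => e + \sum_(j <- s) w j * f j x)%R))%E).
    exact: integrableD.
  by apply/funext => x; rewrite /= big_cons -EFinD addrCA.
under eq_Rintegral do rewrite big_cons addrCA.
by rewrite RintegralD// IH RintegralZl// big_cons addrCA.
Qed.

End BoundedIntegrals.

(** * Order of integration on the product measure *)

Section ProductFubini.
Context {R : realType}.
Local Notation MR := (measurableTypeR R).
Variables (n : nat) (P : 'I_n.+1 -> probability MR R).
Let P0 := P ord0.
Let P' := prodP (fun i : 'I_n => P (lift ord0 i)).
Variables (c : R) (F : n.+1.-tuple MR -> R).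
Hypothesis (mF : measurable_fun setT F) (F1 : forall x, `|F x| <= c).

Let G (z : MR * n.-tuple MR) := F [tuple of z.1 :: z.2].

Let mG : measurable_fun setT G.
Proof. apply: (measurableT_comp mF); exact: measurable_tcons. Qed.

Let iG : (P0 \x P')%E.-integrable setT (EFin \o G).
Proof. by apply: (@prob_bounded_integrable _ _ _ (P0 \x P')%E c) => // z; exact: F1. Qed.

Lemma prodP_integral : (\int[prodP P]_x (F x)%:E = \int[(P0 \x P')%E]_z (G z)%:E)%E.
Proof.
rewrite (@integral_distribution _ _ _ _ _ (P0 \x P')%E (@tcons _ MR n) (EFin \o F))//.
exact/measurable_EFinP.
Qed.

Lemma measurable_sectionl (x : MR) : measurable_fun setT (fun y : n.-tuple MR => F [tuple of x :: y]).
Proof. exact: (measurableT_comp mG (pair1_measurable x)). Qed.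

Lemma measurable_sectionr (y : n.-tuple MR) : measurable_fun setT (fun x : MR => F [tuple of x :: y]).
Proof. exact: (measurableT_comp mG (pair2_measurable y)). Qed.

(** The first variable is integrated last: used to freeze a variable absent from the chosen
    monomial. *)
Lemma prodP_bound_head (K : R) : (forall x : MR, `|\int[P']_y F [tuple of x :: y]| <= K) ->
  `|\int[prodP P]_x F x| <= K.
Proof.
move=> hK; rewrite /Rintegral prodP_integral -integral12_prod_meas1//.
rewrite /fubini_F.
rewrite (eq_integral (EFin \o (fun x : MR => \int[P']_y F [tuple of x :: y]))); last first.
  move=> x _ /=; rewrite /Rintegral fineK//; apply: integrable_fin_num => //.
  apply: (@prob_bounded_integrable _ _ _ _ c) => [|y]; first exact: measurable_sectionl.
  exact: F1.
apply: prob_Rintegral_le => //.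
apply/measurable_EFinP.
rewrite (_ : _ \o _ = fubini_F P' (EFin \o G)); first exact: (measurable_fubini_F iG).
apply/funext => x /=; rewrite /Rintegral fineK//; apply: integrable_fin_num => //.
apply: (@prob_bounded_integrable _ _ _ _ c) => [|y]; first exact: measurable_sectionl.
exact: F1.
Qed.

(** The first variable is integrated first: used when it occurs in the chosen monomial. *)
Lemma prodP_bound_tail (H : n.-tuple MR -> R) : measurable_fun setT H ->
  P'.-integrable setT (EFin \o H) ->
  (forall y : n.-tuple MR, `|\int[P0]_x F [tuple of x :: y]| <= H y) ->
  `|\int[prodP P]_x F x| <= \int[P']_y H y.
Proof.
move=> mH iH hK; rewrite /Rintegral prodP_integral -integral21_prod_meas1//.
have E (y : n.-tuple MR) : (\int[P0]_x (G (x, y))%:E)%E = (\int[P0]_x F [tuple of x :: y])%:E.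
  rewrite /Rintegral fineK//; apply: integrable_fin_num => //.
  apply: (@prob_bounded_integrable _ _ _ _ c) => [|x]; first exact: measurable_sectionr.
  exact: F1.
rewrite (eq_integral (EFin \o (fun y : n.-tuple MR => \int[P0]_x F [tuple of x :: y]))); last first.
  by move=> y _; exact: E.
have iK : P'.-integrable setT (EFin \o (fun y : n.-tuple MR => \int[P0]_x F [tuple of x :: y])).
  apply: (@prob_bounded_integrable _ _ _ _ c).
    apply/measurable_EFinP.
    rewrite (_ : _ \o _ = fubini_G P0 (EFin \o G)); first exact: (measurable_fubini_G iG).
    by apply/funext => y /=; rewrite -E.
  move=> y; apply: prob_Rintegral_le; first exact: measurable_sectionr.
  by move=> x; exact: F1.
apply: le_trans (le_normr_Rintegral _ iK) _ => //.
apply: le_Rintegral => //; exact: integrable_norm iK.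
Qed.

End ProductFubini.

(** * One integration step on term lists *)

Section Peeling.
Context {R : realType}.
Local Notation MR := (measurableTypeR R).

Lemma measurable_sparse_val n (s : seq (R * seq nat)) :
  measurable_fun setT (fun x : n.-tuple MR => sparse_val s x).
Proof.
apply: measurable_sum => t; apply: measurable_funM => //.
apply: measurable_prod => i _; apply: measurable_funX.
exact: measurable_tnth.
Qed.

Variable (B : R).
Hypothesis B0 : 0 <= B.
Let l := (1 + B)^-1.

Variable (phi : R -> R).
Hypothesis mphi : measurable_fun setT phi.
Hypothesis phi1 : forall x, `|phi x| <= 1.

Lemma measurable_phi_sparse n (s : seq (R * seq nat)) :
  measurable_fun setT (fun x : n.-tuple MR => phi (sparse_val s x)).
Proof. apply: (measurableT_comp mphi); exact: measurable_sparse_val. Qed.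

(** [phi] will be the cosine or a capped power. The mixture is applied for all [x] with the same
    weights and base points, so the resulting majorant is an explicit function of [x], ready for the
    next integration. *)
Lemma integrate_first (nu : probability MR R) (rho : MR -> R)
    (n d m j0 : nat) (s : seq (R * seq nat)) (al c eta : R) :
  has_density nu rho -> (BV_seminorm rho <= B%:E)%E ->
  (forall (p : {poly R}) (t : R), (size p <= (minn d m).+1)%N -> 0 <= t <= 1 ->
     `|itv_int (fun y => phi p.[y]) 0 t| <= c * psi al `|p`_j0|) ->
  sparse_wf n.+1 d m s -> 0 < eta ->
  exists w : seq (R * R), [/\ \sum_(p <- w) p.1 <= 3, all (fun p => 0 <= p.1) w &
    forall x : n.-tuple MR, `|\int[nu]_y phi (sparse_val s [tuple of y :: x])| <=
      eta + \sum_(p <- w) p.1 * (c * psi al `|sparse_val (first_coef p.2 l j0 s) x|)].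
Proof.
move=> dens hB h1D wf eta0.
have [w [w01 w3 hw]] := mixture_bound dens B0 eta0 hB.
exists [seq (`|p.1.1|, p.1.2) | p <- w]; split.
- by rewrite big_map.
- by apply/allP => _ /mapP[p _ ->] /=.
move=> x; rewrite big_map.
apply: le_trans (hw (fun y => phi (sparse_val s [tuple of y :: x])) _ _) _ => //.
  have H := @measurable_sectionr R n (fun z => phi (sparse_val s z)) (@measurable_phi_sparse n.+1 s) x.
  exact: H.
rewrite lerD2l big_seq [leRHS]big_seq; apply: ler_sum => p pw.
apply: ler_wpM2l => //.
rewrite -first_poly_coef -/l.
have -> : itv_int (fun y => phi (sparse_val s [tuple of (p.1.2 + l * y) :: x])) 0 p.2 =
    itv_int (fun y => phi (first_poly s p.1.2 l x).[y]) 0 p.2.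
  by apply: eq_Rintegral => y _; rewrite first_poly_val.
apply: h1D; first exact: size_first_poly wf.
by move/allP: w01; apply.
Qed.

End Peeling.

Lemma subn_eq0_step (d j m : nat) : (d < m)%N -> ((d - j).+1 - m = 0)%N.
Proof. lia. Qed.

Lemma subn_peel_step (d j m : nat) : (0 < j)%N -> (j <= d)%N -> (m <= d)%N ->
  (((d - j).+1 - m).+1 <= d.+1 - m)%N.
Proof. lia. Qed.

Lemma subn_peel_first (d j m : nat) : (0 < j)%N -> (j <= d)%N ->
  ((d - j).+1 - m <= d - m)%N.
Proof. lia. Qed.

Lemma subn_peel_lt (d j : nat) : (0 < j)%N -> (j <= d)%N -> ((d - j).+1 <= d)%N.
Proof. lia. Qed.

(** * Induction on the number of variables *)

Section IteratedBounds.
Context {R : realType}.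
Local Notation MR := (measurableTypeR R).
Variables (B : R) (m : nat) (al : R).
Hypotheses (B0 : 0 <= B) (m0 : (0 < m)%N) (al0 : 0 <= al) (alm : al * m%:R < 1).
Let l := (1 + B)^-1.
Let L := (1 - al * m%:R)^-1.
Let c : R := 144 * m%:R ^+ 2.

Let l0 : 0 < l. Proof. by rewrite /l invr_gt0 ltr_wpDr. Qed.

Let alm0 : 0 <= al * m%:R. Proof. by rewrite mulr_ge0. Qed.

Let L1 : 1 <= L.
Proof. by rewrite /L invf_ge1 ?subr_gt0// gerBl. Qed.

Let m1 : 1 <= m%:R :> R. Proof. by rewrite ler1n. Qed.

Let c1 : 1 <= c. Proof. by rewrite /c; have := m1; nra. Qed.

(** The exponent of [L] bounds the number of lossy integrations and is 0 for d < m. In c = 144 m^2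
    the part 144 m is the mixture weight 3 times the one-variable constant 48 m; the other m pays
    for the steps of degree below m. *)
Definition peel_const (d : nat) : R := c ^+ d * L ^+ (d.+1 - m).

Let c0 : 0 <= c. Proof. exact: le_trans c1. Qed.

Let L0 : 0 <= L. Proof. exact: le_trans L1. Qed.

Lemma peel_const_ge0 d : 0 <= peel_const d.
Proof. by rewrite mulr_ge0 ?exprn_ge0. Qed.

Lemma al_lt d : (d <= m)%N -> al * d%:R < 1.
Proof.
by move=> dm; apply: le_lt_trans alm; apply: ler_wpM2l => //; rewrite ler_nat.
Qed.

(** If d < m, then al < 1/m gives 1 - al d >= 1/m and no [L] is spent. If d >= m, exactly one [L] is
    spent, while the degree drops by at least 1. *)
Lemma peel_const_step (d j0 : nat) : (0 < j0)%N -> (j0 <= d)%N ->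
  3 * (48 * (minn d m)%:R / (1 - al * (minn d m)%:R)) * peel_const (d - j0) <= peel_const d.
Proof.
move=> j00 jd.
have cpow : c * c ^+ (d - j0) <= c ^+ d.
  by rewrite -exprS; apply: ler_weXn2l => //; exact: subn_peel_lt.
have cp0 : 0 <= c ^+ (d - j0) by rewrite exprn_ge0.
rewrite /peel_const; have [dm|md] := ltnP d m.
  have -> := subn_eq0_step j0 dm.
  have -> : (d.+1 - m = 0)%N by apply/eqP; rewrite subn_eq0.
  rewrite expr0 !mulr1; apply: le_trans cpow; apply: ler_wpM2r => //.
  have d1 : d%:R + 1 <= m%:R :> R by rewrite natr1 ler_nat.
  have d0 : 0 <= d%:R :> R by [].
  have q0 : 0 < 1 - al * d%:R by rewrite subr_gt0 al_lt// ltnW.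
  rewrite mulrA ler_pdivrMr// /c.
  have : al * d%:R * m%:R <= d%:R by rewrite mulrAC ler_piMl// ltW.
  move: al0 => al0'; set D := d%:R in d1 d0 q0 *; have := m1; set M := m%:R in d1 * => m1'.
  move=> hq; have hM : 1 <= M * (1 - al * D) by lra.
  have : 144 * M * (M * (1 - al * D) - 1) >= 0 by rewrite mulr_ge0; lra.
  lra.
rewrite -/L.
have LL : L * L ^+ ((d - j0).+1 - m) <= L ^+ (d.+1 - m).
  by rewrite -exprS; apply: ler_weXn2l => //; exact: subn_peel_step.
have Lp0 : 0 <= L ^+ ((d - j0).+1 - m) by rewrite exprn_ge0.
have -> : 3 * (48 * m%:R * L) * (c ^+ (d - j0) * L ^+ ((d - j0).+1 - m)) =
  (144 * m%:R * c ^+ (d - j0)) * (L * L ^+ ((d - j0).+1 - m)) by ring.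
apply: ler_pM => //; rewrite ?mulr_ge0//.
apply: le_trans cpow; apply: ler_wpM2r => //; rewrite /c; have := m1; nra.
Qed.

Lemma measurable_psi_norm : measurable_fun setT (fun x : R => psi al `|x|).
Proof.
apply: (@measurableT_comp _ _ _ _ _ _ (psi al) setT (@Num.norm _ R)) => //.
apply: continuous_measurable_fun; exact: continuous_psi.
Qed.

(** The powers l^j0 from the new coefficient and l^(d - j0) from the induction combine to l^d. The
    constants stay abstract because the step serves both the oscillatory integral and the negative
    powers. *)
Lemma first_step_bound n (P : 'I_n.+1 -> probability MR R) (rho : 'I_n.+1 -> MR -> R)
    (phi : R -> R) (d j0 : nat) (j : seq nat) (s : seq (R * seq nat)) (c' Kn : R) :
  measurable_fun setT phi -> (forall x, `|phi x| <= 1) ->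
  (forall i, has_density (P i) (rho i)) -> (forall i, (BV_seminorm (rho i) <= B%:E)%E) ->
  (forall (p : {poly R}) (t : R), (size p <= (minn d m).+1)%N -> 0 <= t <= 1 ->
     `|itv_int (fun y => phi p.[y]) 0 t| <= c' * psi al `|p`_j0|) ->
  0 <= c' -> 0 <= Kn -> sparse_wf n.+1 d m s -> (j0 + sumn j)%N = d ->
  (forall s', sparse_wf n (d - j0) m s' ->
     `|\int[prodP (fun i => P (lift ord0 i))]_x psi al `|sparse_val s' x| | <=
       Kn * psi al (l ^+ (d - j0) * `|sparse_coef s' j|)) ->
  `|\int[prodP P]_x phi (sparse_val s x)| <=
    3 * c' * Kn * psi al (l ^+ d * `|sparse_coef s (j0 :: j)|).
Proof.
move=> mphi phi1 dens hB h1D c'0 Kn0 wf jd IH.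
(* The approximation error is sent to 0 at each step, so errors do not accumulate over the
   variables. *)
apply/ler_addgt0Pr => eta eta0.
have [w [w3 w0 hw]] := integrate_first B0 mphi phi1 (dens ord0) (hB ord0) h1D wf eta0.
set P' := prodP (fun i : 'I_n => P (lift ord0 i)) in IH *.
pose f (p : R * R) (x : n.-tuple MR) := psi al `|sparse_val (first_coef p.2 l j0 s) x|.
have mf p : measurable_fun setT (f p).
  exact: (@measurable_phi_sparse _ (fun x : R => psi al `|x|) measurable_psi_norm).
have f1 p : bounded_by 1 (f p).
  by move=> x; rewrite ger0_norm ?psi_ge0 ?psi_le1.
pose H (x : n.-tuple MR) := eta + \sum_(p <- w) (p.1 * c') * f p x.
have mH : measurable_fun setT H.
  apply: measurable_funD => //; apply: measurable_sum => p.
  by apply: measurable_funM.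
have HE x : H x = eta + \sum_(p <- w) p.1 * (c' * f p x).
  by congr (_ + _); apply: eq_bigr => p _; rewrite mulrA.
have iH : P'.-integrable setT (EFin \o H).
  apply: (@prob_bounded_integrable _ _ _ _ (eta + \sum_(p <- w) `|p.1 * c'|)) => // x.
  apply: le_trans (ler_normD _ _) _; rewrite (gtr0_norm eta0) lerD2l.
  apply: le_trans (ler_norm_sum _ _ _) _; apply: ler_sum => p _.
  by rewrite normrM ler_piMr//; exact: f1.
apply: le_trans (@prodP_bound_tail _ _ P 1 (fun x => phi (sparse_val s x)) _ _ H mH iH _) _.
- exact: measurable_phi_sparse.
- by move=> x; exact: phi1.
- by move=> x; rewrite HE; exact: hw.
rewrite -/P' (prob_Rintegral_sum P' w eta (fun p => p.1 * c') mf f1) addrC lerD2r.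
have hsum p : p \in w -> p.1 * c' * \int[P']_x f p x <=
    p.1 * (c' * (Kn * psi al (l ^+ d * `|sparse_coef s (j0 :: j)|))).
  move=> pw; rewrite -mulrA; apply: ler_wpM2l; first by move/allP: w0; apply.
  apply: ler_wpM2l => //; apply: le_trans (ler_norm _) _.
  apply: le_trans (IH _ (first_coef_wf p.2 l j0 wf)) _.
  rewrite (first_coef_coef p.2 l wf jd) normrM mulrA.
  rewrite (ger0_norm (exprn_ge0 _ (ltW l0))) -exprD subnK// -jd.
  exact: leq_addr.
rewrite big_seq; apply: le_trans (ler_sum _ hsum) _.
rewrite -big_seq -mulr_suml -!mulrA; apply: ler_wpM2r => //.
by rewrite !mulr_ge0// psi_ge0.
Qed.

Lemma sparse_psi_bound n (P : 'I_n -> probability MR R) (rho : 'I_n -> MR -> R)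
    (d : nat) (j : seq nat) (s : seq (R * seq nat)) :
  (forall i, has_density (P i) (rho i)) -> (forall i, (BV_seminorm (rho i) <= B%:E)%E) ->
  sparse_wf n d m s -> size j = n -> sumn j = d ->
  `|\int[prodP P]_x psi al `|sparse_val s x| | <=
    peel_const d * psi al (l ^+ d * `|sparse_coef s j|).
Proof.
elim: n P rho d j s => [|n IH] P rho d j s dens hB wf sj jd.
  (* Without variables d is 0, and 1 - m = 0 in the naturals, so the constant is 1 and both sides
     agree. *)
  move/size0nil: sj jd => -> /= <-.
  rewrite /peel_const !expr0 !mul1r (_ : (1 - m = 0)%N) ?expr0 ?mul1r; last first.
    by apply/eqP; rewrite subn_eq0.
  have -> : \int[prodP P]_x psi al `|sparse_val s x| = psi al `|sparse_coef s [::]|.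
    rewrite /Rintegral /= integral_dirac//; last first.
      apply/measurable_EFinP; exact: (@measurable_phi_sparse _ _ measurable_psi_norm).
    rewrite diracT mul1e /=; congr (psi al `|_|).
    rewrite /sparse_val /sparse_coef [RHS]big_mkcond big_seq [RHS]big_seq.
    apply: eq_bigr => t /(allP wf)/and3P[/eqP/size0nil -> _ _].
    by rewrite /monom_val big_ord0 mulr1.
  by rewrite ger0_norm ?psi_ge0.
case: j sj jd => // j0 j [sj] /= jd.
have mpsi := measurable_psi_norm.
have psi1 (x : R) : `|psi al `|x| | <= 1 by rewrite ger0_norm ?psi_ge0 ?psi_le1.
case: (posnP j0) => [j00|j00].
  rewrite {}j00 add0n in jd *.
  apply: (@prodP_bound_head _ _ P 1 (fun x => psi al `|sparse_val s x|)) => //.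
    exact: (measurable_phi_sparse mpsi).
  move=> x; under eq_Rintegral do rewrite fix_first_val.
  rewrite -(fix_first_coef x wf jd).
  apply: (IH (fun i => P (lift ord0 i)) (fun i => rho (lift ord0 i))) => //.
  exact: fix_first_wf.
have jd0 : (j0 <= d)%N by rewrite -jd leq_addr.
have r0 : (0 < minn d m)%N by rewrite leq_min m0 (leq_trans j00).
have ar : al * (minn d m)%:R < 1 by rewrite al_lt// geq_minr.
have c'0 : 0 <= 48 * (minn d m)%:R / (1 - al * (minn d m)%:R).
  by rewrite divr_ge0 ?mulr_ge0// subr_ge0 ltW.
apply: le_trans (@first_step_bound n P rho (fun x => psi al `|x|) d j0 j s
  (48 * (minn d m)%:R / (1 - al * (minn d m)%:R)) (peel_const (d - j0))
  mpsi psi1 dens hB _ c'0 (peel_const_ge0 _) wf jd _) _.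
- move=> p t sp t01; rewrite ger0_norm; last by apply: Rintegral_ge0 => y _; exact: psi_ge0.
  exact: int_psi_horner_le.
- move=> s' wf'; apply: (IH _ (fun i => rho (lift ord0 i))) => //.
  by rewrite -jd addKn.
- by apply: ler_wpM2r; [exact: psi_ge0|exact: peel_const_step].
Qed.

(** Leading variables absent from the monomial are frozen. The first one present is paid by the
    oscillatory bound, without a factor [L]; the others go through [sparse_psi_bound] in degree at
    most d - 1. This is why the exponent is d - m and not d + 1 - m. *)
Lemma sparse_cos_bound n (P : 'I_n -> probability MR R) (rho : 'I_n -> MR -> R)
    (d : nat) (j : seq nat) (s : seq (R * seq nat)) :
  (forall i, has_density (P i) (rho i)) -> (forall i, (BV_seminorm (rho i) <= B%:E)%E) ->
  sparse_wf n d m s -> size j = n -> sumn j = d -> (0 < d)%N ->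
  `|\int[prodP P]_x cos (sparse_val s x)| <=
    3 * vdc_const m * (c ^+ d * L ^+ (d - m)) * psi al (l ^+ d * `|sparse_coef s j|).
Proof.
elim: n P rho d j s => [|n IH] P rho d j s dens hB wf sj jd d0.
  by move/size0nil: sj jd d0 => -> /= <-.
case: j sj jd => // j0 j [sj] /= jd.
have mcos : measurable_fun setT (@cos R).
  apply: continuous_measurable_fun; exact: continuous_cos.
have cos1 (x : R) : `|cos x| <= 1 by rewrite ler_norml cos_geN1 cos_le1.
case: (posnP j0) => [j00|j00].
  rewrite {}j00 add0n in jd *.
  apply: (@prodP_bound_head _ _ P 1 (fun x => cos (sparse_val s x))) => //.
    exact: (measurable_phi_sparse mcos).
  move=> x; under eq_Rintegral do rewrite fix_first_val.
  rewrite -(fix_first_coef x wf jd).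
  apply: (IH (fun i => P (lift ord0 i)) (fun i => rho (lift ord0 i))) => //.
  exact: fix_first_wf.
have jd0 : (j0 <= d)%N by rewrite -jd leq_addr.
have v1 := vdc_const_ge1 (R := R) m.
have v0 : 0 <= vdc_const m :> R by lra.
apply: le_trans (@first_step_bound n P rho cos d j0 j s
  (vdc_const m) (peel_const (d - j0))
  mcos cos1 dens hB _ v0 (peel_const_ge0 _) wf jd _) _.
- move=> p t sp t01; apply: osc_coef_le => //.
    by apply: leq_trans sp _; rewrite ltnS geq_minr.
  by rewrite -[leRHS]mul1r ler_pdivlMr ?ltr0n// ltW.
- move=> s' wf'; apply: (sparse_psi_bound (rho := fun i => rho (lift ord0 i))) => //.
  by rewrite -jd addKn.
- apply: ler_wpM2r; first exact: psi_ge0.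
  apply: ler_wpM2l; first by rewrite mulr_ge0.
  rewrite /peel_const; apply: ler_pM; rewrite ?exprn_ge0//.
    by apply: ler_weXn2l => //; exact: leq_subr.
  by apply: ler_weXn2l => //; exact: subn_peel_first.
Qed.

End IteratedBounds.

Lemma big_attained (T : Type) (I : eqType) (op : T -> T -> T) (x : T) (s : seq I)
    (P : pred I) (F : I -> T) : (forall a b, op a b = a \/ op a b = b) ->
  \big[op/x]_(i <- s | P i) F i = x \/
  exists2 i, i \in s & P i /\ \big[op/x]_(i <- s | P i) F i = F i.
Proof.
move=> opP; elim: s => [|i s IH]; first by left; rewrite big_nil.
rewrite big_cons; case: (boolP (P i)) => Pi.
  case: (opP (F i) (\big[op/x]_(k <- s | P k) F k)) => ->.
    by right; exists i; rewrite ?inE ?eqxx.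
  by case: IH => [->|[k ks Pk]]; [left|right; exists k; rewrite ?inE ?ks ?orbT].
by case: IH => [->|[k ks Pk]]; [left|right; exists k; rewrite ?inE ?ks ?orbT].
Qed.

(** * Term list and top monomial of a multivariate polynomial *)

Section MpolySparse.
Variables (R : realType) (n : nat).
Implicit Types (f : mpoly n R) (k : multinom n).

(** The phase [th] is one more constant term, possibly repeating the zero exponent; coefficients of
    positive degree do not see it. *)
Definition sparse_of_mpoly (th c : R) f : seq (R * seq nat) :=
  (th, nseq n 0%N) :: [seq (c * mcoeff k f, tval (multinom_val k)) | k <- msupp f].

Lemma sumn_multinom k : sumn (tval (multinom_val k)) = mdeg k.
Proof. by rewrite sumnE. Qed.

Lemma sparse_of_mpoly_val (th c : R) f (x : n.-tuple R) :
  sparse_val (sparse_of_mpoly th c f) x = c * meval (tnth x) f + th.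
Proof.
rewrite /sparse_val big_cons big_map /= addrC mevalE mulr_sumr.
congr (_ + _); last first.
  rewrite /monom_val big1 ?mulr1// => i _; rewrite nth_nseq ltn_ord.
  by rewrite expr0.
apply: eq_bigr => k _; rewrite mulrA; congr (_ * _).
by rewrite /monom_val; apply: eq_bigr => i _; rewrite -mnm_nth.
Qed.

Lemma sparse_of_mpoly_wf (th c : R) f (d m : nat) : in_Pdm d m f ->
  sparse_wf n (total_degree f) m (sparse_of_mpoly th c f).
Proof.
move=> fdm; rewrite /sparse_wf /= size_nseq eqxx sumn_nseq mul0n /=.
rewrite (_ : all _ _)/=; last by apply/allP => _ /nseqP[->].
apply/allP => _ /mapP[k kf ->] /=; rewrite size_tuple eqxx sumn_multinom /=.
apply/andP; split; first by rewrite /total_degree (big_rem k)//= leq_maxl.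
have [_ km] := fdm k kf; apply/allP => e /tnthP[i ->]; exact: km.
Qed.

Lemma sparse_of_mpoly_coef (th c : R) f k : (0 < mdeg k)%N -> k \in msupp f ->
  sparse_coef (sparse_of_mpoly th c f) (tval (multinom_val k)) = c * mcoeff k f.
Proof.
move=> k0 kf; rewrite /sparse_coef big_cons big_map /= ifF; last first.
  apply/negbTE; apply: contraTneq k0 => E.
  by rewrite -sumn_multinom -E sumn_nseq mul0n.
rewrite (eq_bigl (pred1 k)) => [|k' /=]; last by apply/eqP/eqP => [/val_inj/val_inj|->].
by rewrite -big_filter filter_pred1_uniq ?msupp_uniq// big_seq1.
Qed.

Lemma top_monomial f : ~ (exists c : R, f = mpolyC n c) ->
  exists k, [/\ k \in msupp f, mdeg k = total_degree f, (0 < mdeg k)%N &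
    top_coef_norm f = `|mcoeff k f|].
Proof.
move=> fnc.
have [k0 k0f k0d] : exists2 k, k \in msupp f & (0 < mdeg k)%N.
  apply: contrapT => H; apply: fnc; exists (mcoeff (@mnm0 n) f).
  apply/mpolyP => k; rewrite mcoeffC.
  have [->|kn0] := eqVneq k (@mnm0 n); first by rewrite mulr1.
  rewrite mulr0; apply: memN_msupp_eq0; apply/negP => kf.
  by apply: H; exists k => //; rewrite lt0n mdeg_eq0.
have D0 : (0 < total_degree f)%N.
  by rewrite /total_degree (big_rem k0)//= leq_max k0d.
have maxP (a b : nat) : maxn a b = a \/ maxn a b = b.
  by case: (leqP a b); [right|left].
have [E|[k1 k1f [_ k1d]]] := big_attained 0%N (msupp f) predT (@mdeg n) maxP.
  by move: D0; rewrite /total_degree E.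
have k1D : mdeg k1 = total_degree f by rewrite /total_degree k1d.
have maxRP (a b : R) : Num.max a b = a \/ Num.max a b = b.
  by case: (leP a b); [right|left].
have [E|[k kf [/eqP kd kE]]] := big_attained (0 : R) (msupp f)
    (fun k => mdeg k == total_degree f) (fun k => `|mcoeff k f|) maxRP.
  (* The maximum cannot be its default value 0, since the monomial [k1] of top degree has a nonzero
     coefficient. *)
  have : `|mcoeff k1 f| <= top_coef_norm f.
    by apply: (le_bigmax_seq 0 k1) => //; rewrite k1D.
  rewrite /top_coef_norm E normr_le0 => /eqP.
  by move: k1f; rewrite mcoeff_msupp => /eqP.
by exists k; split => //; rewrite kd.
Qed.

End MpolySparse.

(** * Choice of the exponent and the final estimate *)

Section FourierBound.
Context {R : realType}.
Local Notation MR := (measurableTypeR R).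

Lemma BV_seminorm_ge0 (rho : R -> R) : (0 <= BV_seminorm rho)%E.
Proof.
apply: (@le_trans _ _ (1^-1%:E * ereal_sup
  [set \int[lebesgue_measure]_x `|rho (x + h) - rho x|%:E
  | h in [set h : R | (`|h| <= 1)%R]])%E); last first.
  by apply: ereal_sup_ubound; exists 1 => /=.
rewrite invr1 mul1e.
apply: (@le_trans _ _ (\int[lebesgue_measure]_x `|rho (x + 0) - rho x|%:E)%E).
  by apply: integral_ge0 => x _; rewrite lee_fin.
by apply: ereal_sup_ubound; exists 0 => //=; rewrite normr0.
Qed.

Variables (d m n : nat) (nu : 'I_n -> probability MR R) (rho : 'I_n -> MR -> R).
Hypotheses (m0 : (0 < m)%N) (dens : forall j, has_density (nu j) (rho j)).
Hypothesis (hBV : forall j, (BV_seminorm (rho j) < +oo)%E).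
Let B := \big[Num.max/0]_(j < n) fine (BV_seminorm (rho j)).

Let B0 : 0 <= B. Proof. exact: bigmax_ge_id. Qed.

Let hB j : (BV_seminorm (rho j) <= B%:E)%E.
Proof.
rewrite -[leLHS]fineK; last by rewrite ge0_fin_numE ?BV_seminorm_ge0.
rewrite lee_fin; exact: (le_bigmax 0 (fun j => fine (BV_seminorm (rho j))) j).
Qed.

Variables (f : mpoly n R) (t : R).
Hypotheses (hf : in_Pdm d m f) (t0 : t != 0) (hnc : ~ exists c : R, f = mpolyC n c).

Let D := total_degree f.
Let A := top_coef_norm f * `|t|.
Let T := (1 + B)^-1 ^+ D * A.

Lemma cos_mpoly_bound (th al : R) : 0 <= al -> al * m%:R < 1 ->
  `|\int[prodP nu]_x cos (t * meval (tnth x) f + th)| <=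
  3 * vdc_const m * ((144 * m%:R ^+ 2) ^+ D * (1 - al * m%:R)^-1 ^+ (D - m)) * psi al T.
Proof.
move=> al0 alm; have [k [kf kD k0 kE]] := top_monomial hnc.
under eq_Rintegral do rewrite -sparse_of_mpoly_val.
have := sparse_cos_bound B0 m0 al0 alm dens hB (sparse_of_mpoly_wf th t hf)
  (size_tuple (multinom_val k)).
have AE : `|t * mcoeff k f| = A by rewrite normrM mulrC /A kE.
have D0 : (0 < D)%N by rewrite /D -kD.
by rewrite sumn_multinom (sparse_of_mpoly_coef th t k0 kf) AE => /(_ kD D0).
Qed.

Lemma measurable_cos_mpoly (th : R) :
  measurable_fun setT (fun x : n.-tuple MR => cos (t * meval (tnth x) f + th)).
Proof.
rewrite (_ : (fun x => _) = (fun x : n.-tuple MR => cos (sparse_val (sparse_of_mpoly th t f) x))).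
  apply: (measurable_phi_sparse (phi := @cos R)).
  apply: continuous_measurable_fun; exact: continuous_cos.
by apply/funext => x; rewrite sparse_of_mpoly_val.
Qed.

Lemma cos_mpoly_le1 (th : R) :
  `|\int[prodP nu]_x cos (t * meval (tnth x) f + th)| <= 1.
Proof.
apply: prob_Rintegral_le; first exact: measurable_cos_mpoly.
by move=> x; rewrite ler_norml cos_geN1 cos_le1.
Qed.

Lemma top_degree_le : (D <= d)%N.
Proof.
have [k [kf kD _ _]] := top_monomial hnc.
by rewrite /D -kD; have [] := hf kf.
Qed.

Lemma scaled_top_coef_gt0 : 0 < A.
Proof.
have [k [kf _ _ kE]] := top_monomial hnc.
by rewrite /A mulr_gt0 ?normr_gt0// kE normr_gt0 -mcoeff_msupp.
Qed.

(** 6 e collects 2 for real and imaginary part, 3 for the mixture weight of the oscillatory step,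
    and e for the shift of the exponent away from 1/m. *)
Definition fourier_const : R :=
  6 * expR 1 * vdc_const m * (144 * m%:R ^+ 2) ^+ d.

Lemma scale_powR_le : T `^ (- m%:R^-1) <= (1 + B) `^ (d%:R / m%:R) / A `^ (1 / m%:R).
Proof.
have A0 := scaled_top_coef_gt0; have B1 : 1 <= 1 + B by rewrite lerDl.
have BD : 0 < (1 + B) ^+ D by rewrite exprn_gt0// (lt_le_trans ltr01).
rewrite /T powRM ?(ltW A0)//; last by rewrite exprn_ge0// invr_ge0 (le_trans ler01).
rewrite div1r [A `^ _]powRN; apply: ler_wpM2r; first by rewrite invr_ge0 powR_ge0.
rewrite exprVn -powR_inv1 ?(ltW BD)// -powRrM mulN1r opprK -powR_mulrn; last first.
  exact: le_trans B1.
rewrite -powRrM; apply: ler_powR => //; apply: ler_wpM2r.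
  by rewrite invr_ge0.
by rewrite ler_nat top_degree_le.
Qed.

Lemma cos_mpoly_fourier (th : R) :
  2 * `|\int[prodP nu]_x cos (t * meval (tnth x) f + th)| <=
  fourier_const * ((1 + B) `^ (d%:R / m%:R) / A `^ (1 / m%:R)) * (`|ln A| ^+ (d - m) + 1).
Proof.
set Z := (1 + B) `^ _ / _.
have A0 := scaled_top_coef_gt0; have B1 : 1 <= 1 + B by rewrite lerDl.
have m1 : 1 <= m%:R :> R by rewrite ler1n.
have TZ : T `^ (- m%:R^-1) <= Z := scale_powR_le.
have T0 : 0 < T by rewrite mulr_gt0// exprn_gt0// invr_gt0 (lt_le_trans ltr01).
have TA : T <= A.
  rewrite /T ler_piMl ?(ltW A0)// exprn_ile1 ?invr_ge0 ?(le_trans ler01)//.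
  by rewrite invf_le1// (lt_le_trans ltr01).
have e1 : 1 <= expR 1 :> R by rewrite -[1 in leLHS]expR0 ler_expR.
have v1 := vdc_const_ge1 (R := R) m.
have c1 : 1 <= 144 * m%:R ^+ 2 :> R by nra.
have cd1 : 1 <= (144 * m%:R ^+ 2) ^+ d :> R by rewrite exprn_ege1.
have L0 : 0 <= `|ln A| ^+ (d - m) by rewrite exprn_ge0.
have Z0 : 0 <= Z by rewrite divr_ge0 ?powR_ge0.
(* For T <= e the integral is bounded by 1, and T^(-1/m) >= 1/e makes the right-hand side large
   enough. *)
have [Te|Te] := leP T (expR 1).
  have eT : (expR 1)^-1 <= T `^ (- m%:R^-1).
    apply: (@le_trans _ _ ((expR 1) `^ (- m%:R^-1))).
      rewrite -powR_inv1 ?expR_ge0//; apply: ler_powR => //.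
      by rewrite lerN2 invf_le1// (lt_le_trans ltr01).
    by apply: powR_anti => //; rewrite invr_ge0.
  have h1 := cos_mpoly_le1 th.
  have ee : expR 1 * (expR 1)^-1 = 1 :> R by rewrite mulfV// gt_eqF ?expR_gt0.
  have eZ : 1 <= expR 1 * Z.
    rewrite -[leLHS]ee; apply: ler_wpM2l; first exact: expR_ge0.
    exact: le_trans eT TZ.
  have vc : 1 <= vdc_const m * (144 * m%:R ^+ 2) ^+ d :> R by nra.
  have -> : fourier_const * Z * (`|ln A| ^+ (d - m) + 1) =
    6 * (vdc_const m * (144 * m%:R ^+ 2) ^+ d) * (expR 1 * Z) * (`|ln A| ^+ (d - m) + 1).
    by rewrite /fourier_const; ring.
  apply: (@le_trans _ _ 2); first by lra.
  set a := vdc_const m * _ in vc *; set b := expR 1 * Z in eZ *.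
  set x := `|ln A| ^+ _ in L0 *.
  have ab : 1 <= a * b by nra.
  have : 1 <= a * b * (x + 1) by nra.
  rewrite -!mulrA; lra.
have lnT1 : 1 < ln T by rewrite -[1 in ltLHS](expRK 1) ltr_ln// ?posrE ?expR_gt0.
have lnTA : ln T <= ln A by rewrite ler_ln.
(* Now 1 - al m = 1 / ln T, so each loss is exactly ln T; T > e makes [al] nonnegative. *)
pose al := (1 - (ln T)^-1) / m%:R.
have mn0 : m%:R != 0 :> R by rewrite pnatr_eq0 -lt0n.
have li : (ln T)^-1 < 1 by rewrite invf_lt1// (lt_trans ltr01).
have li0 : 0 < (ln T)^-1 by rewrite invr_gt0 (lt_trans ltr01).
have al0 : 0 <= al by rewrite divr_ge0// subr_ge0 ltW.
have almE : al * m%:R = 1 - (ln T)^-1 by rewrite /al divfK.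
have alm : al * m%:R < 1 by rewrite almE gtrBl.
have := cos_mpoly_bound th al0 alm.
rewrite almE opprB addrC subrK invrK => hb.
(* The price of the smaller exponent is T^(1 / (m ln T)) = e^(1/m) <= e. *)
have psiT : psi al T <= expR 1 * T `^ (- m%:R^-1).
  rewrite psi_large; last exact: ltW (le_lt_trans e1 Te).
  have -> : - al = - m%:R^-1 + (ln T)^-1 / m%:R by rewrite /al mulrDl mul1r mulNr opprD opprK.
  rewrite powRD; last by rewrite (gt_eqF T0) implybT.
  rewrite mulrC; apply: ler_wpM2r; first exact: powR_ge0.
  rewrite /powR (gt_eqF T0) mulrAC mulVf ?mul1r ?gt_eqF ?(lt_trans ltr01)//.
  by rewrite ler_expR invf_le1// (lt_le_trans ltr01).
have lnp : ln T ^+ (D - m) <= `|ln A| ^+ (d - m) + 1.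
  have lA1 : 1 <= ln A := le_trans (ltW lnT1) lnTA.
  have lT0 : 0 <= ln T := le_trans ler01 (ltW lnT1).
  have lA0 : 0 <= ln A := le_trans ler01 lA1.
  apply: (@le_trans _ _ (ln A ^+ (d - m))).
    apply: (@le_trans _ _ (ln A ^+ (D - m))).
      by rewrite lerXn2r ?nnegrE.
    apply: ler_weXn2l => //; apply: leq_sub2r; exact: top_degree_le.
  by rewrite (ger0_norm lA0) lerDl.
have cD : (144 * m%:R ^+ 2) ^+ D <= (144 * m%:R ^+ 2) ^+ d :> R.
  by apply: ler_weXn2l => //; exact: top_degree_le.
have cD0 : 0 <= (144 * m%:R ^+ 2) ^+ D :> R by rewrite exprn_ge0// mulr_ge0.
have lnp0 : 0 <= ln T ^+ (D - m) by rewrite exprn_ge0// (le_trans ler01 (ltW lnT1)).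
have -> : fourier_const * Z * (`|ln A| ^+ (d - m) + 1) =
   2 * (3 * vdc_const m * ((144 * m%:R ^+ 2) ^+ d * (`|ln A| ^+ (d - m) + 1)) * (expR 1 * Z)).
  by rewrite /fourier_const; ring.
rewrite ler_pM2l//; apply: le_trans hb _.
have v0 : 0 <= 3 * vdc_const m :> R by rewrite mulr_ge0// (le_trans ler01).
apply: ler_pM; rewrite ?psi_ge0//.
- by rewrite !mulr_ge0.
- by apply: ler_wpM2l => //; apply: ler_pM.
- by apply: le_trans psiT _; apply: ler_wpM2l; rewrite ?expR_ge0.
Qed.

End FourierBound.

Lemma normc_le_norm (R : realType) (a b : R) :
  ComplexField.Normc.normc (Complex a b) <= `|a| + `|b|.
Proof.
rewrite /= -[leRHS]ger0_norm ?addr_ge0// -sqrtr_sqr ler_sqrt ?sqr_ge0//.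
rewrite -(real_normK (num_real a)) -(real_normK (num_real b)) sqrrD.
by rewrite lerD2r lerDl mulrn_wge0// mulr_ge0.
Qed.

Theorem mainTheorem7 (R : realType) (d m : nat)
    (hd : (0 < d)%N) (hm : (0 < m)%N) (hdm : (m <= d)%N) :
  exists C : R,
    forall (n : nat) (hn : (0 < n)%N)
      (nu : 'I_n -> probability (measurableTypeR R) R)
      (rho : 'I_n -> R -> R)
      (hrho : forall j : 'I_n, has_density (nu j) (rho j))
      (hBV : forall j : 'I_n, (BV_seminorm (rho j) < +oo)%E)
      (t : R) (ht : t != 0)
      (f : mpoly n R) (hf : in_Pdm d m f)
      (hnc : ~ exists c : R, f = mpolyC n c),
    ComplexField.Normc.normc
      (Cintegral (prodP nu)
        (fun x : n.-tuple (measurableTypeR R) =>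
           expi (t * meval (tnth x) f)))
    <= (1 + \big[Num.max/0]_(j < n) fine (BV_seminorm (rho j)))
         `^ (d%:R / m%:R)
       * (C / (top_coef_norm f * `|t|) `^ (1 / m%:R))
       * (`|ln (top_coef_norm f * `|t|)| ^+ (d - m) + 1).
Proof.
exists (fourier_const d m) => n _ nu rho hrho hBV t ht f hf hnc.
rewrite /Cintegral; apply: le_trans (normc_le_norm _ _) _.
have bnd th := cos_mpoly_fourier hm hrho hBV hf ht hnc th.
have cosE : \int[prodP nu]_x complex.Re (expi (t * meval (tnth x) f)) =
    \int[prodP nu]_x cos (t * meval (tnth x) f + 0).
  by apply: eq_Rintegral => x _; rewrite addr0.
(* The imaginary part is the cosine integral with phase -pi/2. *)
have sinE : \int[prodP nu]_x complex.Im (expi (t * meval (tnth x) f)) =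
    \int[prodP nu]_x cos (t * meval (tnth x) f + - (pi / 2)).
  by apply: eq_Rintegral => x _; rewrite cosBpihalf.
rewrite cosE sinE.
(* Each of the two bounds is for twice an integral, so their sum is compared with twice the goal. *)
rewrite -(ler_pM2l (ltr0n R 2)) mulrDr.
apply: le_trans (lerD (bnd 0) (bnd (- (pi / 2)))) _.
rewrite -mulr2n -[leLHS]mulr_natl ler_pM2l// [leLHS]mulrAC.
rewrite le_eqVlt; apply/orP; left; apply/eqP; ring.
Qed.
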